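(* For every positive integer $n$ with $n \equiv 30 \pmod{70}$, $$\mathrm{ex}_{\mathcal{P}}(n,C_{4}) = \frac{15}{7}(n-2).$$
   Context: Graphs are finite and simple. A graph is called $H$-free if it does not contain the graph $H$ as a subgraph (whether induced or not). $\mathrm{ex}_{\mathcal{P}}(n,H)$ denotes the maximum number of edges possible in a planar $H$-free graph on $n$ vertices. $C_{4}$ denotes the cycle of length $4$. *)

(* Defs.v *)
From HB Require Import structures.
From mathcomp Require Import all_boot all_order all_algebra.
From mathcomp Require Import all_classical all_reals all_analysis.

Set Implicit Arguments.
Unset Strict Implicit.
Unset Printing Implicit Defensive.

Import Order.TTheory GRing.Theory Num.Theory.
Import numFieldNormedType.Exports.

Local Open Scope classical_set_scope.
Local Open Scope ring_scope.

Record sgraph (T : finType) := SGraph {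
  edges : {set {set T}};
  _ : [forall e in edges, #|e| == 2%N] }.

HB.instance Definition _ (T : finType) := [isSub for @edges T].
HB.instance Definition _ (T : finType) := [Finite of sgraph T by <:].

(* Not necessarily induced: G may have further edges among the f x. *)
Definition contains (S T : finType) (H : sgraph S) (G : sgraph T) : Prop :=
  exists f : S -> T,
    injective f /\ forall e, e \in edges H -> f @: e \in edges G.

Definition subgraph_free (S T : finType) (H : sgraph S) (G : sgraph T) : Prop :=
  ~ contains H G.

(* ordS i is the successor of i modulo k. *)
Definition cycle_edges (k : nat) : {set {set 'I_k}} :=
  [set [set i; ordS i]%SET | i : 'I_k]%SET.

Lemma cycle_edges_card (k : nat) :
  (2 < k)%N -> [forall e in cycle_edges k, #|e| == 2%N].
Proof.
move=> k_gt2; apply/forall_inP => _ /imsetP[i _ ->]; rewrite cards2.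
suff -> : i != ordS i by [].
apply/eqP => /(congr1 val) /= iE; have := ltn_ord i; rewrite leq_eqVlt.
case/predU1P => [iK | ltik]; last first.
  by move: iE; rewrite modn_small // => /n_Sn.
by move: iE k_gt2; rewrite iK modnn => i0; rewrite -iK i0.
Qed.

Definition cycle_graph (k : nat) (k_gt2 : (2 < k)%N) : sgraph 'I_k :=
  SGraph (cycle_edges_card k_gt2).

Definition C4 : sgraph 'I_4 := cycle_graph (isT : (2 < 4)%N).

Definition simple_arc (R : realType) (g : R -> R * R) : Prop :=
  {within `[0, 1], continuous g} /\ {in `[0, 1] &, injective g}.

Definition plane_drawing (R : realType) (T : finType) (G : sgraph T)
    (pos : T -> R * R) (arc : {set T} -> R -> R * R) : Prop :=
  [/\ injective pos,
      forall e, e \in edges G ->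
        simple_arc (arc e) /\
        exists u v, [/\ e = [set u; v]%SET, arc e 0 = pos u & arc e 1 = pos v],
      forall (e : {set T}) (t : R) (v : T),
        e \in edges G -> t \in `]0, 1[ -> arc e t <> pos v
    & forall (e f : {set T}) (s t : R),
        e \in edges G -> f \in edges G -> e != f ->
        s \in `]0, 1[ -> t \in `]0, 1[ -> arc e s <> arc f t].

Definition planar (R : realType) (T : finType) (G : sgraph T) : Prop :=
  exists (pos : T -> R * R) (arc : {set T} -> R -> R * R),
    plane_drawing G pos arc.

(* Graphs on n vertices are taken on the vertex set 'I_n, which loses nothing *)
(* up to isomorphism. The maximum over an empty family is 0; the family is    *)
(* nonempty as soon as H has an edge, thanks to the edgeless graph.           *)
Definition ex_planar (R : realType) (n : nat) (S : finType) (H : sgraph S) :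
    nat :=
  \max_(G : sgraph 'I_n | `[< planar R G /\ subgraph_free H G >]) #|edges G|.

(* Main.v *)
From Stdlib Require Import ZArith.
Require Import Defs.
From mathcomp Require Import all_boot all_order all_algebra.
From mathcomp Require Import all_classical all_reals all_analysis.
From mathcomp Require Import zify ssrZ ring lra.

(** Upper bound.  In a plane graph without a 4-cycle, degenerate cases apart, the
    faces have size 3 or at least 5, and two triangles never share an edge, so
    that counting sides of faces gives 15 f <= 8 e; with Euler's formula this
    becomes 7 e <= 15 (n - 2).  Faces enter the proof only through MacLane's
    description of them: the cycle space of a planar graph over the field with
    two elements is spanned by vectors such that each edge lies in at most two
    of them.  Such a spanning family replaces the faces, the equation
    dim = e - n + c replaces Euler's formula, and the count is
    [two_basis_count].

    The spanning family comes from a square grid, which avoids the Jordan curve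
    theorem.  Each arc of a drawing is cut into three thirds.  The outer thirds
    around a vertex form compact stars that are pairwise disjoint, the middle
    thirds are pairwise disjoint, and compactness leaves a positive distance
    between the pieces that do not meet.  On a fine grid, the cells visited by
    the stars are therefore disjoint connected sets, joined by the cells visited
    by the middle thirds: the graph is a minor of the grid
    ([planar_grid_minor]).  In the grid, an even set of edges is the coboundary
    of a function on the corners, a partial sum along a column
    ([boundary_exact]); and a spanning family with at most two members through
    each edge passes from the grid to its minors ([minor_two_basis]).

    Lower bound.  Equality holds when every edge is on one triangle and one
    pentagon.  Take the fullerene tube Q made of two dodecahedral caps and 6 k
    rings of five hexagons, and a set S of vertices of Q that meets every
    hexagon exactly once and no pentagon.  The vertices of the graph [tube k]
    are S and the edges of Q that avoid S; each vertex of Q outside S gives a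
    triangle on the three vertices that correspond to its edges, where an edge
    towards S counts as its end in S.  A face of Q then has five vertices
    outside S and becomes a pentagon.  For k = 0 this is the icosidodecahedron.
    The pattern is periodic, with 70 vertices and 150 edges for six rings, and
    it is drawn with straight edges so that each period is the previous one
    magnified 32 times.  Absence of 4-cycles and of crossings is computed for
    k <= 2 and propagates to all k because both are local and the period
    repeats ([no_square], [local_ind]). *)

Set Implicit Arguments.
Unset Strict Implicit.
Unset Printing Implicit Defensive.

Import Order.TTheory GRing.Theory Num.Theory.
Import numFieldNormedType.Exports.

Delimit Scope Z_scope with ZZ.

Local Open Scope classical_set_scope.
Local Open Scope ring_scope.

(** * Cycle spaces over the field with two elements *)

Definition weight (q : nat) (z : 'rV[bool]_q) : nat := #|[set i | z 0 i]%SET|.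

(** The type [bool], with exclusive or as addition, is the field with two
    elements: a row vector indexed by the edges is a set of edges, and it is in
    the kernel of the incidence matrix when all its degrees are even. *)
Definition incidence (T : finType) (G : sgraph T) : 'M[bool]_(#|edges G|, #|T|) :=
  \matrix_(i < #|edges G|, x < #|T|) ((enum_val x : T) \in (enum_val i : {set T})).

Definition cycle_space (T : finType) (G : sgraph T) :
    'M[bool]_#|edges G| :=
  kermx (incidence G).

Lemma card_edge (T : finType) (G : sgraph T) (e : {set T}) :
  e \in edges G -> #|e| = 2%N.
Proof. by case: G => E /= /forall_inP GE /GE/eqP. Qed.

Lemma sum_bool_odd (I : finType) (A : {set I}) :
  \sum_(i in A) (true : bool) = odd #|A|.
Proof.
by rewrite big_const; elim: #|_| => //= n ->.
Qed.

(** Every edge has two ends, so the columns of the incidence matrix add up to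
    zero and its rank is less than the number of vertices. *)
Lemma cycle_space_rank (T : finType) (G : sgraph T) :
  (0 < #|T|)%N -> (#|edges G| < \rank (cycle_space G) + #|T|)%N.
Proof.
move=> T_gt0; rewrite mxrank_ker.
have zero : incidence G *m const_mx 1 = 0 :> 'cV_#|edges G|.
  apply/matrixP => i j; rewrite !mxE.
  under eq_bigr do rewrite !mxE mulr1.
  transitivity (\sum_(x in (enum_val i : {set T})) (true : bool)).
    rewrite [RHS]big_mkcond [RHS](reindex (fun i : 'I_#|T| => enum_val i : T)) /=; last first.
      by apply: onW_bij; exact: enum_val_bij.
    by apply: eq_bigr => x _; case: ifP.
  by rewrite sum_bool_odd (card_edge (enum_valP i)).
have := mulmx0_rank_max zero.
have -> : \rank (const_mx 1 : 'M[bool]_(#|T|, 1)) = 1%N.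
  apply/eqP; rewrite eqn_leq rank_leq_col lt0n mxrank_eq0.
  apply/eqP => /matrixP /(_ (Ordinal T_gt0) 0); by rewrite !mxE.
by have := rank_leq_row (incidence G); lia.
Qed.

Definition support (T : finType) (G : sgraph T) (z : 'rV[bool]_#|edges G|) :
    {set {set T}} :=
  [set enum_val i | i in [set i | z 0 i]]%SET.

Lemma card_support (T : finType) (G : sgraph T) (z : 'rV[bool]_#|edges G|) :
  #|support z| = weight z.
Proof. by rewrite card_imset //; exact: enum_val_inj. Qed.

Lemma support_sub (T : finType) (G : sgraph T) (z : 'rV[bool]_#|edges G|) :
  support z \subset edges G.
Proof. by apply/fintype.subsetP => _ /imsetP[i _ ->]; exact: enum_valP. Qed.

Lemma support_even (T : finType) (G : sgraph T) (z : 'rV[bool]_#|edges G|) :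
  (z <= cycle_space G)%MS ->
  forall x, \sum_(e in support z) (x \in e : bool) = 0.
Proof.
move/sub_kermxP => /matrixP zI x; have := zI 0 (enum_rank x).
rewrite !mxE => zI0; rewrite -[RHS]zI0 big_imset /=; last first.
  by move=> i j _ _; exact: enum_val_inj.
rewrite [LHS]big_mkcond; apply: eq_bigr => i _.
by rewrite !mxE enum_rankK inE; case: (z 0 i); case: (x \in _).
Qed.

Lemma even_next (T : finType) (S : {set {set T}}) (e : {set T}) (x : T) :
  \sum_(e in S) (x \in e : bool) = 0 -> e \in S -> x \in e ->
  exists f, [/\ f \in S, f != e & x \in f].
Proof.
move=> ev eS xe; case: (pickP [pred f | [&& f \in S, f != e & x \in f]]) => [f|no].
  by case/and3P; exists f.
move: ev; rewrite (bigD1 e) //= big1 ?addr0 ?xe // => f /andP[fS fe].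
by have := no f; rewrite /= fS fe /=.
Qed.

Lemma edge_at (T : finType) (G : sgraph T) (e : {set T}) (x : T) :
  e \in edges G -> x \in e -> exists2 y, y != x & e = [set x; y]%SET.
Proof.
move/card_edge/eqP/cards2P => [a [b [ab ->]]]; rewrite !inE.
by case/orP => /eqP ->; [exists b; rewrite 1?eq_sym|exists a; rewrite // finset.setUC].
Qed.

(** From an edge ab, evenness provides further edges ac and bd.  If there are
    exactly four edges, the fourth has to repair the parities left over by these
    three: none is left over when c = d, and the fourth edge is cd otherwise,
    which closes a 4-cycle. *)
Lemma even_card (T : finType) (G : sgraph T) (S : {set {set T}}) :
  subgraph_free C4 G -> S \subset edges G ->
  (forall x, \sum_(e in S) (x \in e : bool) = 0) ->
  S != finset.set0 -> #|S| = 3%N \/ (4 < #|S|)%N.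
Proof.
move=> free /fintype.subsetP SG ev /set0Pn[e eS].
have /eqP/cards2P[a [b [ab eE]]] := card_edge (SG _ eS).
have [f [fS fe af]] : exists f, [/\ f \in S, f != e & a \in f].
  by apply: even_next => //; rewrite eE !inE eqxx.
have [g [gS ge bg]] : exists f, [/\ f \in S, f != e & b \in f].
  by apply: even_next => //; rewrite eE !inE eqxx orbT.
have [c ca fE] := edge_at (SG _ fS) af.
have [d db gE] := edge_at (SG _ gS) bg.
have cb : c != b by apply: contraNneq fe => cb; rewrite fE eE cb.
have da : d != a by apply: contraNneq ge => da; rewrite gE eE da finset.setUC.
have fg : f != g.
  apply: contraTneq af => ->; rewrite gE !inE (negPf ab) /=.
  by rewrite eq_sym (negPf da).
have sub3 : [set e; f; g]%SET \subset S.
  by apply/fintype.subsetP => s; rewrite !inE => /orP[/orP[]|] /eqP ->.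
have card3 : #|[set e; f; g]%SET| = 3%N.
  by rewrite finset.setUC cardsU1 cards2 !inE negb_or ge eq_sym fg eq_sym fe.
have := subset_leq_card sub3; rewrite card3 leq_eqVlt => /predU1P[<-|]; first by left.
rewrite leq_eqVlt => /predU1P[S4|]; last by right.
exfalso.
have /eqP/cards1P[h Sh] : #|S :\: [set e; f; g]%SET| = 1%N.
  by rewrite cardsD (finset.setIidPr sub3) card3 -S4.
have SE : S = (h |: (g |: [set e; f]))%SET.
  rewrite -[LHS](finset.setID S [set e; f; g]%SET) (finset.setIidPr sub3) Sh.
  apply/setP => x; rewrite !inE.
  by case: (x == e); case: (x == f); case: (x == g); case: (x == h).
have hN : h \notin [set e; f; g]%SET.
  by have := finset.set11 h; rewrite -Sh inE => /andP[].
have hS : h \in S by rewrite SE !inE eqxx.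
have hx x : (x \in h) = (x \in e) (+) (x \in f) (+) (x \in g).
  have := ev x; rewrite SE big_setU1 ?big_setU1 ?big_setU1 ?big_set1 //=.
  - by case: (x \in h); case: (x \in e); case: (x \in f); case: (x \in g).
  - by rewrite inE eq_sym.
  - by rewrite !inE negb_or ge eq_sym.
  - by move: hN; rewrite !inE !negb_or => /andP[/andP[-> ->] ->].
have [cd|cd] := eqVneq c d.
  have /eqP/cards2P[p [q [_ hE]]] := card_edge (SG _ hS).
  have := hx p; rewrite {1}hE !inE eqxx /= eE fE gE !inE -cd.
  case: (eqVneq p a) => [->|pa]; first by rewrite (negPf ab) eq_sym (negPf ca).
  case: (eqVneq p b) => [->|pb]; first by rewrite eq_sym (negPf cb).
  by case: (p == c).
have ch : c \in h.
  by rewrite hx eE fE gE !inE (negPf ca) (negPf cb) eqxx (negPf cd).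
have dh : d \in h.
  by rewrite hx eE fE gE !inE (negPf da) (negPf db) eqxx eq_sym (negPf cd).
have [d' d'c hE] := edge_at (SG _ hS) ch.
have {d' d'c} hE : h = [set c; d]%SET.
  by move: dh; rewrite {1}hE !inE eq_sym (negPf cd) /= => /eqP ->.
apply: free; exists (fun i : 'I_4 => nth a [:: a; b; d; c] i); split.
  move=> i j /eqP; rewrite nth_uniq //= ?ltn_ord //.
    by move/eqP/val_inj.
  rewrite !inE !negb_or ab eq_sym da eq_sym ca [b == d]eq_sym db [b == c]eq_sym cb.
  by rewrite eq_sym cd.
have im (x y : T) (i j : 'I_4) (F : 'I_4 -> T) : F @: [set i; j]%SET = [set F i; F j]%SET.
  by rewrite imsetU1 imset_set1.
move=> _ /imsetP[i _ ->]; rewrite im //.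
case: i => -[|[|[|[|//]]]] ? /=.
- by rewrite -eE SG.
- by rewrite -gE SG.
- by rewrite finset.setUC -hE SG.
- by rewrite finset.setUC -fE SG.
Qed.

(** The weight 4 is excluded by the absence of 4-cycles, the weights 1 and 2 by
    the graph being simple. *)
Lemma cycle_weight (T : finType) (G : sgraph T) (z : 'rV[bool]_#|edges G|) :
  subgraph_free C4 G -> (z <= cycle_space G)%MS -> z != 0 ->
  weight z = 3%N \/ (4 < weight z)%N.
Proof.
move=> free zZ z0; rewrite -card_support; apply: even_card free _ _ _ => //.
- exact: support_sub.
- exact: support_even.
- apply: contra_neq z0 => /eqP; rewrite -cards_eq0 card_support cards_eq0 => /eqP z0.
  apply/rowP => i; rewrite mxE; apply/negbTE/negP => zi.
  by have : i \in [set i | z 0 i]%SET; [rewrite inE|rewrite z0 inE].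
Qed.

Lemma card_set_sum (I : finType) (P : pred I) : #|[set i | P i]%SET| = (\sum_i P i)%N.
Proof. by rewrite -sum1_card big_mkcond; apply: eq_bigr => i _; rewrite inE; case: (P i). Qed.

Lemma weightE (q : nat) (z : 'rV[bool]_q) : weight z = (\sum_i z 0%R i)%N.
Proof. exact: card_set_sum. Qed.

Lemma weightD (q : nat) (x y : 'rV[bool]_q) :
  (weight (x + y) + (#|[set i | x 0%R i && y 0%R i]%SET|).*2 = weight x + weight y)%N.
Proof.
rewrite !weightE card_set_sum -mul2n big_distrr /=.
rewrite -!big_split /=; apply: eq_bigr => i _.
by rewrite !mxE; case: (x 0 i); case: (y 0 i).
Qed.

(** The rows of B play the role of the bounded faces and their sum that of the
    outer face.  If f = rank + 1 is the number of faces and t the number of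
    triangles, then 2 q >= 3 t + 5 (f - t); moreover 3 t <= q, because the sum
    of two triangles with a common edge would have weight 2 or 4. *)
Lemma two_basis_count (m q : nat) (Z : 'M[bool]_q) (B : 'M[bool]_(m, q)) :
  (Z == B)%MS ->
  (forall i, (\sum_k B k i <= 2)%N) ->
  (forall z : 'rV_q, (z <= Z)%MS -> z != 0 -> weight z = 3%N \/ (4 < weight z)%N) ->
  (1 < \rank Z)%N -> (15 * (\rank Z).+1 <= 8 * q)%N.
Proof.
move=> /andP[ZB BZ] colB wtZ; have /eqP -> : \rank Z == \rank B by rewrite eqn_leq !mxrankS.
set r : nat := \rank B => r_gt1; set f := maxrankfun B; set D := rowsub f B.
have freeD : row_free D := maxrowsub_free B.
have DB : (D <= B)%MS by rewrite /D eq_maxrowsub.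
(* The faces are indexed by [option 'I_r], with [None] for the outer one; [u]
   gives their coordinates in the basis D, and r > 1 makes these distinct. *)
pose u (o : option 'I_r) : 'rV[bool]_r := if o is Some k then delta_mx 0 k else const_mx 1.
have u_inj : injective u.
  have nconst k : delta_mx 0 k != const_mx 1 :> 'rV[bool]_r.
    have [l lk] : exists l : 'I_r, l != k.
      case: k => -[|k] ? ; first by exists (Ordinal r_gt1).
      by exists (Ordinal (ltnW r_gt1)).
    by apply/eqP => /rowP/(_ l); rewrite !mxE eqxx (negPf lk).
  move=> [k|] [l|] //=.
  - move/rowP/(_ k); rewrite !mxE !eqxx /=.
    by case: eqVneq => // ->.
  - by move/eqP; rewrite (negPf (nconst k)).
  - by move/esym/eqP; rewrite (negPf (nconst l)).
have u_neq0 o : u o != 0.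
  case: o => [k|]; first by apply/eqP => /rowP/(_ k); rewrite !mxE !eqxx.
  by apply/eqP => /rowP/(_ (Ordinal r_gt1)); rewrite !mxE.
pose F o := u o *m D.
have FZ o : (F o <= Z)%MS.
  exact: submx_trans (submxMl _ _) (submx_trans DB BZ).
have F_inj : injective F.
  by move=> a b /(row_free_inj freeD)/u_inj.
have F_neq0 o : F o != 0 by rewrite mulmx_free_eq0.
(* The sum of the rows contains the edges that lie in exactly one row. *)
have colF i : (\sum_o F o 0%R i <= 2)%N.
  have -> : (\sum_o F o 0%R i = (\sum_k D k i) + odd (\sum_k D k i))%N.
    have FN : F None 0 i = odd (\sum_k D k i)%N.
      transitivity (\sum_k D k i).
        by rewrite [LHS]mxE; apply: eq_bigr => k _; rewrite [in X in X * _]mxE mul1r.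
      elim/big_rec2: _ => // k b c _ ->; rewrite oddD; by case: (D k i).
    rewrite (bigD1 None) //= FN addnC; congr addn.
    rewrite (reindex_omap Some id) /=; last by case.
    by apply: eq_big => k; rewrite ?eqxx // => _; rewrite /F -rowE mxE.
  have : (\sum_k D k i <= 2)%N.
    apply: leq_trans (colB i).
    under eq_bigr do rewrite mxE.
    rewrite -(big_imset (fun k => nat_of_bool (B k i))) /=; last first.
      by move=> a b _ _; exact: maxrankfun_inj.
    rewrite [leqRHS](bigID (mem (f @: 'I_r))) /=.
    exact: leq_addr.
  by case: (\sum_k D k i)%N => [|[|[|]]].
have triF o o' i : weight (F o) = 3%N -> weight (F o') = 3%N -> F o 0 i -> F o' 0 i -> o = o'.
  move=> wo wo' oi oi'; apply/eqP/negPn/negP => neq.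
  have xy0 : F o + F o' != 0.
    apply: contraNneq neq => xy0; apply/eqP/F_inj.
    apply/rowP => j; move/rowP/(_ j): xy0; rewrite mxE [RHS]mxE.
    by case: (F o 0 j); case: (F o' 0 j).
  have [c c_gt0 wD] : exists2 c, (0 < c)%N & (weight (F o + F o')%R + c.*2 = 6)%N.
    exists #|[set i | F o 0%R i && F o' 0%R i]%SET|; last by rewrite weightD wo wo'.
    by apply/card_gt0P; exists i; rewrite inE oi.
  move: (weight _) (wtZ _ (addmx_sub (FZ o) (FZ o')) xy0) wD => w.
  by clear -c_gt0; lia.
pose tri := [set o | weight (F o) == 3%N]%SET.
have tri_q : (3 * #|tri| <= q)%N.
  have -> : (3 * #|tri| = \sum_(o in tri) weight (F o))%N.
    rewrite mulnC -sum_nat_const; apply: eq_bigr => o; by rewrite inE => /eqP.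
  under eq_bigr do rewrite weightE.
  rewrite exchange_big /= -[leqRHS]card_ord -sum1_card.
  apply: leq_sum => i _.
  have [/= s /andP[ot oi]|no] := pickP (fun o => (o \in tri) && F o 0 i); last first.
    by rewrite big1 // => o ot; have := no o; rewrite ot /= => ->.
  rewrite (bigD1 s) //= big1 ?addn0 ?leq_b1 // => o' /andP[ot' o'o].
  apply/eqP; rewrite eqb0; apply: contra_neqN o'o => oi'.
  by move: ot ot'; rewrite !inE => /eqP ot /eqP ot'; apply: triF oi' oi.
have sumF : (\sum_o weight (F o) <= 2 * q)%N.
  under eq_bigr do rewrite weightE.
  rewrite exchange_big /= mulnC -[q in leqRHS]card_ord -sum_nat_const.
  by apply: leq_sum => i _; exact: colF.
have : (5 * r.+1 <= \sum_o weight (F o) + 2 * #|tri|)%N.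
  have -> : (2 * #|tri| = \sum_o (if o \in tri then 2 else 0))%N.
    by rewrite -big_mkcond sum_nat_const mulnC.
  have -> : (r.+1 = #|{: option 'I_r}|)%N by rewrite card_option card_ord.
  rewrite mulnC -sum_nat_const -big_split /=; apply: leq_sum => o _.
  by have := wtZ _ (FZ o) (F_neq0 o); rewrite inE; case: eqP => [->|] // ? []; lia.
by lia.
Qed.

(** When the cycle space has rank at most 1 there are no two faces to count,
    but then there are at most as many edges as vertices. *)
Lemma edge_bound (T : finType) (G : sgraph T) (m : nat) (B : 'M[bool]_(m, #|edges G|)) :
  (3 < #|T|)%N -> subgraph_free C4 G -> (cycle_space G == B)%MS ->
  (forall i, (\sum_k B k i <= 2)%N) ->
  (7 * #|edges G| <= 15 * (#|T| - 2))%N.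
Proof.
move=> T_gt3 free ZB colB.
have := cycle_space_rank G (ltn_trans (isT : 0 < 3)%N T_gt3).
have [r_le1|r_gt1] := leqP (\rank (cycle_space G)) 1; first by lia.
have := two_basis_count ZB colB (fun z zZ z0 => cycle_weight free zZ z0) r_gt1.
by lia.
Qed.

(** * Even edge sets of a grid are coboundaries *)

(** The grid is a torus, so that sums over cells can be shifted.  The edge
    [(true, p)] leads from the cell p to its right neighbour and [(false, p)] to
    its upper neighbour.  A pair of coordinates also names a corner, the lower
    left one of that cell; an edge [a] separates the corners [target a] and
    [corner a]. *)
Notation cell N := ('I_N.+2 * 'I_N.+2)%type.
Notation gedge N := (bool * cell N)%type.

Definition target (N : nat) (a : gedge N) : cell N :=
  if a.1 then (a.2.1 + 1, a.2.2) else (a.2.1, a.2.2 + 1).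

Definition corner (N : nat) (a : gedge N) : cell N :=
  (a.2.1 + 1, a.2.2 + 1).

Definition boundary (N : nat) (z : gedge N -> bool)
    (p : cell N) : bool :=
  \sum_a z a * ((a.2 == p) + (target a == p)).

Definition coboundary (N : nat) (w : cell N -> bool)
    (a : gedge N) : bool :=
  w (target a) + w (corner a).

(** The boundary is adjoint to the difference of a function along edges. *)
Lemma boundary_pairing (N : nat) (z : gedge N -> bool)
    (f : cell N -> bool) :
  \sum_p f p * boundary z p = \sum_a z a * (f a.2 + f (target a)).
Proof.
under eq_bigr do rewrite mulr_sumr.
rewrite exchange_big /=; apply: eq_bigr => a _.
under eq_bigr do rewrite mulrCA mulrDr.
rewrite -mulr_sumr big_split /=; congr (_ * (_ + _)).
  rewrite (bigD1 a.2) //= eqxx mulr1 big1 ?addr0 // => p pa.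
  by rewrite eq_sym (negPf pa) mulr0.
rewrite (bigD1 (target a)) //= eqxx mulr1 big1 ?addr0 // => p pa.
by rewrite eq_sym (negPf pa) mulr0.
Qed.

Lemma boundaryE (N : nat) (z : gedge N -> bool) (i j : 'I_N.+2) :
  boundary z (i, j) =
  z (true, (i, j)) + z (true, (i - 1, j)) + (z (false, (i, j)) + z (false, (i, j - 1))).
Proof.
transitivity (\sum_d \sum_p z (d, p) * ((p == (i, j)) + (target (d, p) == (i, j)))).
  by rewrite pair_bigA; apply: eq_bigr => -[d p] _.
rewrite big_bool; congr (_ + _).
  under eq_bigr do rewrite mulrDr.
  rewrite big_split /=; congr (_ + _).
    rewrite (bigD1 (i, j)) //= eqxx mulr1 big1 ?addr0 // => p /negPf ->.
    by rewrite mulr0.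
  rewrite (bigD1 (i - 1, j)) //= /target /= subrK eqxx mulr1 big1 ?addr0 // => -[p1 p2] /=.
  by rewrite !xpair_eqE -(inj_eq (addIr 1)) subrK => /negPf ->; rewrite mulr0.
under eq_bigr do rewrite mulrDr.
rewrite big_split /=; congr (_ + _).
  rewrite (bigD1 (i, j)) //= eqxx mulr1 big1 ?addr0 // => p /negPf ->.
  by rewrite mulr0.
rewrite (bigD1 (i, j - 1)) //= /target /= subrK eqxx mulr1 big1 ?addr0 // => -[p1 p2] /=.
by rewrite !xpair_eqE -[p2 == _](inj_eq (addIr 1)) subrK => /negPf ->; rewrite mulr0.
Qed.

(** Around a cell each of the four corners is met by two of the four edges. *)
Lemma boundary_coboundary (N : nat) (w : cell N -> bool) p :
  boundary (coboundary w) p = 0.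
Proof.
case: p => i j; rewrite boundaryE /coboundary /target /corner /= !subrK.
by case: (w (i, j)); case: (w (i + 1, j)); case: (w (i, j + 1)); case: (w _).
Qed.

Lemma cyclic_ind (N : nat) (P : 'I_N.+2 -> Prop) :
  P 0 -> (forall j, P j -> P (j + 1)) -> forall j, P j.
Proof.
move=> P0 PS j; rewrite -[j]natr_Zp; elim: (nat_of_ord j) => [|n IH]; first by rewrite mulr0n.
by rewrite -natr1; exact: PS.
Qed.

Lemma val_succ (N : nat) (j : 'I_N.+2) : nat_of_ord (j + 1) = (j.+1 %% N.+2)%N.
Proof. by rewrite /= ?modnDmr addn1. Qed.

(** On the torus this needs a hypothesis: no edge that is used starts in column
    0 or ends in row or column 0, where the torus is cut open.  The corner
    function counts the crossings of a vertical ray, and the evenness of the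
    cells makes it jump correctly across the edges of the other direction
    too. *)
Lemma boundary_exact (N : nat) (z : gedge N -> bool) :
  (forall p, boundary z p = 0) ->
  (forall a, z a -> [&& a.2.1 != 0, (target a).1 != 0 & (target a).2 != 0]) ->
  exists w, z =1 coboundary w.
Proof.
move=> bd0 pad.
have up i : z (false, (i, -1)) = false.
  by apply/negP => /pad /=; rewrite /target /= addrC subrr eqxx !andbF.
(* Evenly many edges are used between two neighbouring columns: this is true
   after column 0 and passes to the next column by adding up the boundaries of
   its cells. *)
have tot i : \sum_j z (true, (i, j)) = 0.
  elim/cyclic_ind: i => [|i IH].
    by apply: big1 => j _; apply: negbTE; apply/negP => /pad /and3P[/eqP].
  have : \sum_j boundary z (i + 1, j) = 0 by apply: big1 => j _; exact: bd0.
  under eq_bigr do rewrite boundaryE addrK.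
  rewrite big_split /= big_split /= IH addr0 big_split /=.
  rewrite [X in _ + (_ + X)](reindex_inj (addIr 1)) /=.
  under [X in _ + (_ + X)]eq_bigr do rewrite addrK.
  by case: (\sum_i0 z (false, _)); rewrite ?addr0.
pose s i n : bool := \sum_(k < n) z (true, (i - 1, k%:R)).
pose w (p : cell N) := s p.1 (nat_of_ord p.2).
have wE i j : w (i, j) = s i (nat_of_ord j) by [].
have wt i j : w (i, j + 1) = w (i, j) + z (true, (i - 1, j)).
  rewrite !wE; have := ltn_ord j; rewrite leq_eqVlt => /predU1P[jN|jN].
    have -> : nat_of_ord (j + 1) = 0%N by rewrite val_succ jN modnn.
    rewrite /s big_ord0; have := tot (i - 1).
    have -> : \sum_j z (true, (i - 1, j)) = \sum_(k < j.+1) z (true, (i - 1, k%:R)).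
      by rewrite jN; apply: eq_bigr => k _; rewrite natr_Zp.
    by rewrite big_ord_recr /= natr_Zp => ->.
  have -> : nat_of_ord (j + 1) = j.+1 by rewrite val_succ modn_small.
  by rewrite /s big_ord_recr /= natr_Zp.
have w0 i : w (i, 0) = 0 by rewrite wE /s big_ord0.
have wf i j : z (false, (i, j)) = w (i, j + 1) + w (i + 1, j + 1).
  elim/cyclic_ind: j => [|j IH].
    have := bd0 (i, 0); rewrite boundaryE !wt !w0 addrK sub0r up.
    by case: (z _); case: (z _); case: (z _).
  have := bd0 (i, j + 1); rewrite boundaryE wt [w (i + 1, j + 1 + 1)]wt !addrK IH.
  by case: (z _); case: (z _); case: (z _); case: (w _); case: (w _).
exists w => -[[] [i j]]; rewrite /coboundary /target /corner /=; last exact: wf.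
by rewrite wt addrK; case: (w _); case: (z _).
Qed.

(** * Minors of a grid have a two-fold spanning family of cycles *)

(** Being joined by a path inside a branch set is expressed by an edge set with
    the two cells as its boundary, which is all that is used of the path. *)
Definition linked (T : finType) (N : nat) (phi : cell N -> option T) (v : T)
    (p q : cell N) : Prop :=
  exists2 z : gedge N -> bool,
    (forall a, z a -> phi a.2 = Some v /\ phi (target a) = Some v) &
    forall x, boundary z x = (p == x) + (q == x).

(** The branch set of v is the preimage of [Some v]; [None] marks the cells that
    belong to no branch set. *)
Definition grid_minor (T : finType) (G : sgraph T) (N : nat)
    (phi : cell N -> option T) : Prop :=
  [/\ forall p, phi p != None -> (p.1 != 0) && (p.2 != 0),
      forall p q v, phi p = Some v -> phi q = Some v -> linked phi v p q
    & forall e, e \in edges G -> exists a u v,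
        [/\ phi a.2 = Some u, phi (target a) = Some v & e = [set u; v]%SET]].

Lemma boundaryD (N : nat) (z1 z2 : gedge N -> bool) p :
  boundary (fun a => z1 a + z2 a) p = boundary z1 p + boundary z2 p.
Proof. by rewrite /boundary -big_split; apply: eq_bigr => a _; rewrite mulrDl. Qed.

Lemma boundary_sum (I : finType) (N : nat) (c : I -> bool) (z : I -> gedge N -> bool) p :
  boundary (fun a => \sum_i c i * z i a) p = \sum_i c i * boundary (z i) p.
Proof.
rewrite /boundary; under eq_bigr do rewrite mulr_suml.
rewrite exchange_big /=; apply: eq_bigr => i _; rewrite mulr_sumr.
by apply: eq_bigr => a _; rewrite mulrA.
Qed.

Lemma boundary_single (N : nat) (a : gedge N) p :
  boundary (fun b => b == a) p = (a.2 == p) + (target a == p).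
Proof.
rewrite /boundary (bigD1 a) //= eqxx mul1r big1 ?addr0 // => b /negPf ->.
by rewrite mul0r.
Qed.

Lemma addrr_bool (b : bool) : b + b = 0. Proof. by case: b. Qed.

(** Call an edge of the grid allowed if it lies inside a branch set or was
    chosen to represent an edge of the graph.  A cycle of the graph extends
    through the branch sets to an even set of allowed edges, hence to the
    coboundary of a function that is constant on the classes of corners
    connected across edges that are not allowed.  Conversely, the coboundary of
    such a function restricts to a cycle, by summing its evenness over a branch
    set.  So the classes act as faces: the indicator of each one gives a cycle,
    these span, and an edge separates at most two classes. *)
Lemma minor_two_basis (T : finType) (G : sgraph T) (N : nat) (phi : cell N -> option T) :
  grid_minor G phi ->
  exists2 B : 'M[bool]_(#|{: cell N}|, #|edges G|),
    (cycle_space G == B)%MS & forall i, (\sum_k B k i <= 2)%N.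
Proof.
case=> pad conn cross.
pose E := 'I_#|edges G|; pose edge (i : E) : {set T} := enum_val i.
have /choice[eps epsP] : forall i : E, exists a : gedge N, exists uv : T * T,
    [/\ phi a.2 = Some uv.1, phi (target a) = Some uv.2 & edge i = [set uv.1; uv.2]%SET].
  by move=> i; have [a [u [v ?]]] := cross _ (enum_valP i); exists a, (u, v).
have {epsP} /choice[uv epsP] := epsP.
have uvN i : (uv i).1 != (uv i).2.
  have [_ _ ei] := epsP i; have := card_edge (enum_valP i); rewrite -/(edge i) ei cards2.
  by case: eqP.
have eps_inj : injective eps.
  move=> i j ij; have [pi qi ei] := epsP i; have [pj qj ej] := epsP j.
  apply: enum_val_inj; rewrite -/(edge i) -/(edge j) ei ej.
  by move: pi qi; rewrite ij pj qj => -[->] [->].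
have in_edge i x : (x \in edge i) = (x == (uv i).1) + (x == (uv i).2) :> bool.
  have [_ _ ->] := epsP i; rewrite !inE.
  by case: eqVneq => [->|]; [rewrite (negPf (uvN i))|case: eqP].
(* [A] is the set of allowed edges and [rt] picks a corner in each class. *)
pose inner (a : gedge N) := (phi a.2 != None) && (phi a.2 == phi (target a)).
pose A a := inner a || (a \in codom eps).
have inner_eps i : inner (eps i) = false.
  have [p q _] := epsP i; rewrite /inner p q /=; apply/eqP => -[] /eqP.
  by rewrite (negPf (uvN i)).
have A_pad a : A a -> [&& a.2.1 != 0, (target a).1 != 0 & (target a).2 != 0].
  move=> Aa; have [p0 q0] : phi a.2 != None /\ phi (target a) != None.
    case/orP: Aa => [/andP[p0 /eqP q0]|/codomP[i ->]]; first by rewrite -q0.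
    by have [-> -> _] := epsP i.
  by have /andP[-> _] := pad _ p0; exact: pad.
pose R := [rel c d | [exists a, ~~ A a &&
  ((c == target a) && (d == corner a) || (d == target a) && (c == corner a))]].
have R_sym : connect_sym R.
  by apply: sym_connect_sym => c d /=; apply: eq_existsb => a; rewrite orbC.
pose rt := fingraph.root R.
have rtA a : ~~ A a -> rt (target a) = rt (corner a).
  move=> nA; apply/(fingraph.rootP R_sym)/connect1/existsP; exists a.
  by rewrite nA !eqxx.
have rt_const (w : cell N -> bool) :
    (forall a, ~~ A a -> w (target a) = w (corner a)) -> forall c, w (rt c) = w c.
  move=> wA c; have : connect R c (rt c) := connect_root R c.
  case/connectP => s; move: (rt c) => r; elim: s c => [|d s IH] c /=; first by move=> _ ->.
  case/andP => /existsP[a /andP[nA cd]] sP rE; rewrite (IH d) //.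
  by case/orP: cd => /andP[/eqP -> /eqP ->]; rewrite wA.
pose B : 'M[bool]_(#|{: cell N}|, #|edges G|) := \matrix_(k, i)
  ((rt (target (eps i)) == enum_val k) + (rt (corner (eps i)) == enum_val k)).
exists B; last first.
  move=> i; have one (c : cell N) : (\sum_(k < #|{: cell N}|) (c == enum_val k) = 1)%N.
    rewrite (bigD1 (enum_rank c)) //= enum_rankK eqxx big1 // => k kc.
    by apply/eqP; rewrite eqb0; apply: contraNneq kc => ->; rewrite enum_valK.
  rewrite [2%N in leqRHS](_ : _ = 1 + 1)%N // -{1}(one (rt (target (eps i)))).
  rewrite -(one (rt (corner (eps i)))) -big_split; apply: leq_sum => k _; rewrite mxE.
  by case: (_ == _); case: (_ == _).
apply/andP; split; last first.
  apply/row_subP => k; apply/sub_kermxP/rowP => x; rewrite !mxE.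
  pose w c : bool := rt c == enum_val k.
  pose f (p : cell N) : bool := phi p == Some (enum_val x).
  have := boundary_pairing (coboundary w) f.
  rewrite big1 => [|p _]; last by rewrite boundary_coboundary mulr0.
  rewrite (bigID (mem (codom eps))) /= [X in _ + X]big1 ?addr0 => [|a aN]; last first.
    have [inn|ninn] := boolP (inner a).
      by case/andP: inn => _ /eqP e; rewrite /f e addrr_bool mulr0.
    have nA : ~~ A a by rewrite /A negb_or ninn.
    by rewrite /coboundary /w rtA // addrr_bool mul0r.
  move/esym=> s0; apply: etrans s0; rewrite -big_uniq ?codom_uniq /=; last exact/injectiveP.
  rewrite big_image /=; apply: eq_bigr => i _.
  rewrite !mxE -/(edge i) in_edge /f; have [-> -> _] := epsP i.
  by rewrite !(inj_eq Some_inj) [_ == (uv i).1]eq_sym [_ == (uv i).2]eq_sym.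
(* It remains to write a cycle z in terms of B: [P i] is a walk that runs from
   the base of one end of the edge i to the base of the other end. *)
apply/rV_subP => z zZ.
have /choice[base baseP] : forall v : T, exists b : cell N,
    forall p, phi p = Some v -> phi b = Some v.
  move=> v; case: (pselect (exists p, phi p = Some v)) => [[p pv]|no]; first by exists p.
  by exists (0, 0) => p pv; case: no; exists p.
have /choice[P PP] : forall i : E, exists P : gedge N -> bool,
    [/\ forall a, P a -> A a, forall j, P (eps j) = (j == i)
      & forall x, boundary P x = (base (uv i).1 == x) + (base (uv i).2 == x)].
  move=> i; have [p q _] := epsP i.
  have [P1 P1v P1b] := conn _ _ _ (baseP _ _ p) p.
  have [P2 P2v P2b] := conn _ _ _ (baseP _ _ q) q.
  have in1 a : P1 a -> inner a by move=> /P1v[e1 e2]; rewrite /inner e1 e2 eqxx.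
  have in2 a : P2 a -> inner a by move=> /P2v[e1 e2]; rewrite /inner e1 e2 eqxx.
  exists (fun a => (a == eps i) + (P1 a + P2 a)); split.
  - move=> a; rewrite /A; case: (boolP (P1 a)) => [/in1 -> //|_].
    case: (boolP (P2 a)) => [/in2 -> //|_]; case: eqP => // -> _.
    by rewrite codom_f orbT.
  - move=> j; have -> : P1 (eps j) = false by apply/negP => /in1; rewrite inner_eps.
    have -> : P2 (eps j) = false by apply/negP => /in2; rewrite inner_eps.
    by rewrite (inj_eq eps_inj) !addr0.
  - move=> x; rewrite boundaryD boundaryD boundary_single P1b P2b.
    by case: (_ == _); case: (_ == _); case: (_ == _); case: (_ == _).
pose z' a : bool := \sum_i z 0 i * P i a.
have z'A a : ~~ A a -> z' a = 0.
  move=> nA; apply: big1 => i _; have [PA _ _] := PP i.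
  by rewrite (contraNF (PA a) nA) mulr0.
have bd0 x : boundary z' x = 0.
  rewrite boundary_sum.
  transitivity (\sum_v (base v == x) * (z *m incidence G) 0 (enum_rank v)); last first.
    by apply: big1 => v _; rewrite (sub_kermxP zZ) mxE mulr0.
  under [RHS]eq_bigr do rewrite mxE mulr_sumr.
  rewrite exchange_big /=; apply: eq_bigr => i _.
  have [_ _ ->] := PP i.
  under eq_bigr do rewrite mxE enum_rankK -/(edge i) mulrCA in_edge mulrDr.
  rewrite -mulr_sumr big_split /=; congr (_ * (_ + _)).
    rewrite (bigD1 (uv i).1) //= eqxx mulr1 big1 ?addr0 // => v /negPf ->.
    by rewrite mulr0.
  rewrite (bigD1 (uv i).2) //= eqxx mulr1 big1 ?addr0 // => v /negPf ->.
  by rewrite mulr0.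
have [w wz] : exists w, z' =1 coboundary w.
  apply: boundary_exact => // a z'a; apply: A_pad; apply: contraTT z'a => /z'A ->.
  by [].
have wA a : ~~ A a -> w (target a) = w (corner a).
  by move=> /z'A; rewrite wz /coboundary; case: (w _); case: (w _).
have wrt := rt_const w wA.
apply/submxP; exists (\row_k w (enum_val k)); apply/rowP => i; rewrite mxE.
have -> : z 0 i = coboundary w (eps i).
  rewrite -wz /z' (bigD1 i) //= big1 ?addr0 => [|j ji].
    by have [_ -> _] := PP i; rewrite eqxx mulr1.
  by have [_ -> _] := PP j; rewrite eq_sym (negPf ji) mulr0.
under eq_bigr do rewrite !mxE mulrDr.
have pick_one (c : cell N) :
    \sum_(k < #|{: cell N}|) w (enum_val k) * (rt c == enum_val k) = w c.
  rewrite (bigD1 (enum_rank (rt c))) //= enum_rankK eqxx mulr1 wrt big1 ?addr0 // => k kc.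
  rewrite [_ == _](_ : _ = false) ?mulr0 //; apply: contraNF kc => /eqP ->.
  by rewrite enum_valK.
by rewrite big_split /= !pick_one.
Qed.

(** * From walks in a grid to a minor *)

Definition adjacent (N : nat) (p q : cell N) : Prop :=
  p = q \/ exists d, q = target (d, p) \/ p = target (d, q).

Lemma linked_refl (T : finType) (N : nat) (phi : cell N -> option T) v p :
  linked phi v p p.
Proof.
by exists (fun=> 0) => // x; rewrite addrr_bool /boundary big1.
Qed.

Lemma linked_sym (T : finType) (N : nat) (phi : cell N -> option T) v p q :
  linked phi v p q -> linked phi v q p.
Proof. by case=> z zv zb; exists z => // x; rewrite zb addrC. Qed.

Lemma linked_trans (T : finType) (N : nat) (phi : cell N -> option T) v p q r :
  linked phi v p q -> linked phi v q r -> linked phi v p r.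
Proof.
case=> z zv zb [y yv yb]; exists (fun a => z a + y a).
  by move=> a; case za: (z a); [move=> _; exact: zv|exact: yv].
move=> x; rewrite boundaryD zb yb.
by case: (p == x); case: (q == x); case: (r == x).
Qed.

Lemma linked_step (T : finType) (N : nat) (phi : cell N -> option T) v p q :
  adjacent p q -> phi p = Some v -> phi q = Some v -> linked phi v p q.
Proof.
case=> [<- _ _|[d pq] pv qv]; first exact: linked_refl.
case: pq => e; [|apply: linked_sym]; rewrite e;
  [exists (fun b => b == (d, p))|exists (fun b => b == (d, q))].
- by move=> a /eqP ->; rewrite /= -e.
- exact: boundary_single.
- by move=> a /eqP ->; rewrite /= -e.
- exact: boundary_single.
Qed.

(** Each edge is a walk of three stages of length L between the homes of its
    ends.  [X v] collects the cells of the outer stages at v and [M e] those of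
    the middle stage, which may overlap with the [X v] of its own ends.  The
    branch set of v is [X v] extended along the middle stages that leave v as
    their tail, up to the first cell in the [X] of the head; the step into that
    cell represents the edge. *)
Lemma grid_minor_of_walks (T : finType) (G : sgraph T) (N L : nat)
    (tail head : {set T} -> T) (home : T -> cell N) (walk : {set T} -> nat -> cell N)
    (X := fun v p => p = home v \/ exists e k, [/\ e \in edges G, p = walk e k
       & (k <= L)%N /\ tail e = v \/ (2 * L <= k <= 3 * L)%N /\ head e = v])
    (M := fun e p => exists2 k, (L <= k <= 2 * L)%N & p = walk e k) :
  (forall e, e \in edges G -> e = [set tail e; head e]%SET) ->
  (forall e k, e \in edges G -> (k < 3 * L)%N -> adjacent (walk e k) (walk e k.+1)) ->
  (forall e, e \in edges G -> walk e 0 = home (tail e)) ->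
  (forall e, e \in edges G -> walk e (3 * L)%N = home (head e)) ->
  (forall v, (home v).1 != 0 /\ (home v).2 != 0) ->
  (forall e k, e \in edges G -> (k <= 3 * L)%N ->
     (walk e k).1 != 0 /\ (walk e k).2 != 0) ->
  (forall u v p, X u p -> X v p -> u = v) ->
  (forall e v p, e \in edges G -> M e p -> X v p -> v \in e) ->
  (forall e f p, e \in edges G -> f \in edges G -> M e p -> M f p -> e = f) ->
  exists phi : cell N -> option T, grid_minor G phi.
Proof.
move=> eE step walk0 walkL home_pad walk_pad XX MX MM.
pose B p v := X v p \/ exists e k, [/\ e \in edges G, tail e = v, (L <= k <= 2 * L)%N,
  p = walk e k & forall l, (L <= l <= k)%N -> ~ X (head e) (walk e l)].
have XB u p e k : X u p -> [/\ e \in edges G, (L <= k <= 2 * L)%N, p = walk e k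
    & forall l, (L <= l <= k)%N -> ~ X (head e) (walk e l)] -> u = tail e.
  move=> Xu [eG kL pk nX]; have : u \in e by apply: MX Xu => //; exists k.
  rewrite {1}(eE _ eG) !inE => /orP[/eqP //|/eqP uh].
  by case: (nX k); [case/andP: kL => -> _ /=|rewrite -uh -pk].
have B_fun p u v : B p u -> B p v -> u = v.
  case=> [Xu|[e [k [eG eu kL pk nX]]]] [Xv|[f [l [fG fv lL pl nX']]]].
  - exact: XX Xu Xv.
  - by rewrite -fv; apply: (XB _ _ _ l Xu).
  - by rewrite -eu; apply/esym/(XB _ _ _ k Xv).
  - by rewrite -eu -fv (MM e f p) //; [exists k|exists l].
(* No cell gets two owners, so that [B] is the graph of a partial function. *)
pose phi p := if pselect (exists v, B p v) is left h then Some (projT1 (cid h)) else None.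
have phiP p v : phi p = Some v <-> B p v.
  rewrite /phi; case: pselect => [h|no]; last by split=> // Bpv; case: no; exists v.
  case: (cid h) => u Bu /=; split=> [[<-] //|Bv]; congr Some; exact: B_fun Bu Bv.
have along e i j v : (i <= j <= 3 * L)%N -> e \in edges G ->
    (forall l, (i <= l <= j)%N -> B (walk e l) v) -> linked phi v (walk e i) (walk e j).
  case/andP=> /subnK <-; elim: (j - i)%N => [|k IH] kL eG Bv; first exact: linked_refl.
  apply: linked_trans (IH _ eG _) (linked_step (step e (k + i)%N eG kL) _ _); first exact: ltnW.
  - by move=> l lk; apply: Bv; lia.
  - by apply/phiP/(Bv (k + i)%N); lia.
  - by apply/phiP/(Bv (k.+1 + i)%N); lia.
have Bt e k : e \in edges G -> (k <= L)%N -> B (walk e k) (tail e).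
  by move=> eG kL; left; right; exists e, k; split=> //; left.
have Bh e k : e \in edges G -> (2 * L <= k <= 3 * L)%N -> B (walk e k) (head e).
  by move=> eG kL; left; right; exists e, k; split=> //; right.
have to_home p v : B p v -> linked phi v (home v) p.
  case=> [[->|[e [k [eG -> [[kL <-]|[kL <-]]]]]]|[e [k [eG <- kL -> nX]]]].
  - exact: linked_refl.
  - rewrite -walk0 //; apply: along => //; first by lia.
    by move=> l lk; apply: Bt => //; lia.
  - rewrite -walkL //; apply/linked_sym/along => //; first by lia.
    by move=> l lk; apply: Bh => //; lia.
  - rewrite -walk0 //; apply: along => //; first by lia.
    move=> l lk; case: (leqP l L) => lL; first exact: Bt.
    right; exists e, l; split=> //; first by lia.
    by move=> m ml; apply: nX; lia.
exists phi; split.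
- move=> p; case pv: (phi p) => [v|//] _.
  case/phiP: pv => [[->|[e [k [eG -> kL]]]]|[e [k [eG _ kL -> _]]]].
  + exact/andP/home_pad.
  + by apply/andP/walk_pad => //; lia.
  + by apply/andP/walk_pad => //; lia.
- move=> p q v /phiP pv /phiP qv.
  exact: linked_trans (linked_sym (to_home _ _ pv)) (to_home _ _ qv).
- move=> e eG; pose hit k := (L <= k)%N && `[< X (head e) (walk e k) >].
  have hitL : exists k, hit k.
    exists (2 * L)%N; apply/andP; split; first by lia.
    by apply/asboolP; right; exists e, (2 * L)%N; split=> //; right; split=> //; lia.
  have neq : tail e != head e.
    by have := card_edge eG; rewrite {1}(eE _ eG) cards2; case: eqP.
  case: (ex_minnP hitL) => k /andP[Lk /asboolP Xk] kmin.
  have k2L : (k <= 2 * L)%N.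
    apply: kmin; apply/andP; split; first by lia.
    by apply/asboolP; right; exists e, (2 * L)%N; split=> //; right; split=> //; lia.
  have LkN : (L < k)%N.
    rewrite ltn_neqAle Lk andbT; apply: contraNneq neq => Lk'; apply/eqP.
    apply: XX Xk; right; exists e, k; split=> //; left; split=> //; lia.
  have pk : phi (walk e k.-1) = Some (tail e).
    apply/phiP; right; exists e, k.-1; split=> //; first by lia.
    move=> l lk Xl; suff : (k <= l)%N by lia.
    by apply: kmin; apply/andP; split; [lia|apply/asboolP].
  have qk : phi (walk e k) = Some (head e) by apply/phiP; left.
  have : adjacent (walk e k.-1) (walk e k).
    by rewrite -[in X in adjacent _ X](ltn_predK LkN); apply: step => //; lia.
  case=> [pq|[d [pq|pq]]].
  + by move: pk; rewrite pq qk => -[/esym/eqP]; rewrite (negPf neq).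
  + by exists (d, walk e k.-1), (tail e), (head e); rewrite -pq; split=> //; exact: eE.
  + exists (d, walk e k), (head e), (tail e); rewrite -pq; split=> //.
    by rewrite finset.setUC; exact: eE.
Qed.

(** * Compactness of plane drawings *)

Lemma compact_separated (R : realType) (A B : set (R * R)) :
  compact A -> compact B -> A `&` B = set0 ->
  \forall d \near 0^'+, forall x y, A x -> B y -> ~ ball x d y.
Proof.
move=> cA cB AB0; move/compact_near_coveringP : cA => cA.
have clB : closed B by apply: compact_closed cB; exact: (@norm_hausdorff R (R * R)%type).
have H : \forall d \near 0^'+, A `<=` [set x | forall y, B y -> ~ ball x d y].
  apply: cA => x Ax.
  have nBx : nbhs x (~` B).
    apply: open_nbhs_nbhs; split; first exact: closed_openC.
    by move=> Bx; have : (A `&` B) x by []; rewrite AB0.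
  case/nbhs_ballP: nBx => r /= r0 rB.
  have r20 : 0 < r / 2 by rewrite divr_gt0.
  near=> x' d => y By xy; apply: (rB y) => //.
  have /le_ball : r / 2 + d <= r.
    rewrite [leRHS](splitr r) lerD2l; apply/ltW; near: d.
    exact: nbhs_right_lt.
  apply; apply: ball_triangle xy; near: x'.
  exact: nbhsx_ballx.
by apply: filterS H => d dA x y Ax By; exact: dA.
Unshelve. all: by end_near. Qed.

Lemma arc_uniform (R : realType) (g : R -> R * R) (d : R) :
  {within `[0, 1], continuous g} -> 0 < d ->
  \forall n \near \oo, forall s t, s \in `[0, 1] -> t \in `[0, 1] ->
    `|s - t| <= n.+1%:R^-1 -> ball (g s) d (g t).
Proof.
move=> /subspace_continuousP gc d0.
have : compact (`[0, 1]%classic : set R) by exact: segment_compact.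
move/compact_near_coveringP => cI.
have H : \forall n \near \oo, `[0, 1]%classic `<=` [set s : R | forall t, t \in `[0, 1] ->
    `|s - t| <= n.+1%:R^-1 -> s \in `[0, 1] -> ball (g s) d (g t)].
  apply: cI => s0 s0I.
  have d20 : 0 < d / 2 by rewrite divr_gt0.
  have : \forall s \near s0, `[0, 1]%classic s -> ball (g s0) (d / 2) (g s).
    exact: (gc s0 s0I _ (nbhsx_ballx (g s0) (d / 2) d20)).
  case/nbhs_ballP => r /= r0 rg.
  have r20 : 0 < r / 2 by rewrite divr_gt0.
  have r2r : r / 2 <= r by rewrite [leRHS]splitr lerDl ltW.
  near=> s n => /= t tI st sI.
  have ss0 : ball s0 (r / 2) s by near: s; exact: nbhsx_ballx.
  have nr : n.+1%:R^-1 < r / 2 by near: n; exact: near_infty_natSinv_lt (PosNum r20).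
  rewrite [d]splitr; apply: (@ball_triangle _ _ (g s0)).
    by apply: ball_sym; exact: (rg s (le_ball r2r ss0) sI).
  have sr : ball s (r / 2) t by exact: le_lt_trans st nr.
  have tr : ball s0 r t by rewrite [r]splitr; exact: ball_triangle ss0 sr.
  exact: (rg t tr tI).
by apply: filterS H => n nA s t sI tI st; apply: nA.
Unshelve. all: by end_near. Qed.

Lemma arc_image_compact (R : realType) (g : R -> R * R) (a b : R) :
  {within `[0, 1], continuous g} -> 0 <= a -> b <= 1 -> compact (g @` `[a, b]).
Proof.
move=> gc a0 b1; apply: continuous_compact; last exact: segment_compact.
apply: continuous_subspaceW gc => x /=; rewrite !in_itv /= => /andP[ax xb].
by rewrite (le_trans a0) // (le_trans xb).
Qed.

Definition at_end (R : realType) (T : finType) (tail head : {set T} -> T)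
    (e : {set T}) (t : R) (v : T) : Prop :=
  t = 0 /\ tail e = v \/ t = 1 /\ head e = v.

(** A drawing orients every edge by the direction in which its arc is run
    through. *)
Definition oriented_by (R : realType) (T : finType) (G : sgraph T) (pos : T -> R * R)
    (arc : {set T} -> R -> R * R) (tail head : {set T} -> T) : Prop :=
  forall e, e \in edges G ->
    [/\ e = [set tail e; head e]%SET, arc e 0 = pos (tail e) & arc e 1 = pos (head e)].
Lemma drawing_ends (R : realType) (T : finType) (G : sgraph T) pos arc :
  @plane_drawing R T G pos arc -> T ->
  exists tail head, oriented_by G pos arc tail head.
Proof.
case=> _ arcs _ _ x0.
have /choice[uv uvP] : forall e, exists uv : T * T, e \in edges G ->
    [/\ e = [set uv.1; uv.2]%SET, arc e 0 = pos uv.1 & arc e 1 = pos uv.2].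
  move=> e; have [/arcs[_ [u [v uvP]]]|eN] := boolP (e \in edges G).
    by exists (u, v).
  by exists (x0, x0).
by exists (fun e => (uv e).1), (fun e => (uv e).2).
Qed.

Lemma unit_cases (R : realType) (t : R) :
  t \in `[0, 1] -> [\/ t = 0, t = 1 | t \in `]0, 1[].
Proof.
rewrite !in_itv /= => /andP[]; rewrite le_eqVlt => /predU1P[<-|t0]; first by constructor 1.
rewrite le_eqVlt => /predU1P[->|t1]; first by constructor 2.
by constructor 3; rewrite t0.
Qed.

Lemma drawing_vertex (R : realType) (T : finType) (G : sgraph T) pos arc tail head :
  @plane_drawing R T G pos arc ->
  oriented_by G pos arc tail head ->
  forall e t v, e \in edges G -> t \in `[0, 1] -> arc e t = pos v ->
  at_end tail head e t v.
Proof.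
case=> pos_inj _ avoid _ ends e t v eG /unit_cases tI etv.
have [_ e0 e1] := ends e eG; case: tI => [t0|t1|tI].
- by left; split=> //; apply: pos_inj; rewrite -e0 -etv t0.
- by right; split=> //; apply: pos_inj; rewrite -e1 -etv t1.
- by have := avoid _ _ _ eG tI etv.
Qed.

Lemma drawing_meet (R : realType) (T : finType) (G : sgraph T) pos arc tail head :
  @plane_drawing R T G pos arc ->
  oriented_by G pos arc tail head ->
  forall e f s t, e \in edges G -> f \in edges G -> s \in `[0, 1] -> t \in `[0, 1] ->
  arc e s = arc f t ->
  (e = f /\ s = t) \/ exists v, at_end tail head e s v /\ at_end tail head f t v.
Proof.
move=> D ends; have on_vertex := drawing_vertex D ends.
case: D => _ arcs _ avoid e f s t eG fG sI tI est.
have end_pos g r : g \in edges G -> r = 0 \/ r = 1 -> exists v, arc g r = pos v.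
  by move=> /ends[_ g0 g1] [->|->]; [exists (tail g)|exists (head g)].
have meet v : arc e s = pos v -> exists v, at_end tail head e s v /\ at_end tail head f t v.
  move=> ev; exists v; split; first exact: on_vertex.
  by apply: on_vertex => //; rewrite -est.
case: (unit_cases sI) => [s0|s1|s01].
- by right; have [v] := end_pos e s eG (or_introl s0); exact: meet.
- by right; have [v] := end_pos e s eG (or_intror s1); exact: meet.
case: (unit_cases tI) => [t0|t1|t01].
- by right; have [v] := end_pos f t fG (or_introl t0); rewrite -est; exact: meet.
- by right; have [v] := end_pos f t fG (or_intror t1); rewrite -est; exact: meet.
left; have [ef|ef] := eqVneq e f; last by case: (avoid e f s t eG fG ef s01 t01).
split=> //; have [[_ inj] _] := arcs e eG.
by apply: inj => //; rewrite est ef.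
Qed.

(** The pieces of a drawing are its vertices and the thirds of its arcs. *)
Definition third (R : realType) (j : 'I_3) : set R := `[j%:R / 3%:R, j.+1%:R / 3%:R].

Definition piece (R : realType) (T : finType) (pos : T -> R * R)
    (arc : {set T} -> R -> R * R) (i : T + {set T} * 'I_3) : set (R * R) :=
  match i with inl v => [set pos v] | inr (e, j) => arc e @` @third R j end.

Definition drawn (T : finType) (G : sgraph T) (i : T + {set T} * 'I_3) : bool :=
  if i is inr (e, _) then e \in edges G else true.

Lemma third_unit (R : realType) (j : 'I_3) (t : R) : @third R j t -> t \in `[0, 1].
Proof.
rewrite /third /= !in_itv /= => /andP[jt tj]; apply/andP; split.
  by apply: le_trans jt; rewrite divr_ge0.
by apply: le_trans tj _; rewrite ler_pdivrMr // mul1r ler_nat.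
Qed.

Lemma piece_compact (R : realType) (T : finType) (G : sgraph T) pos arc i :
  @plane_drawing R T G pos arc -> drawn G i -> compact (piece pos arc i).
Proof.
case=> _ arcs _ _; case: i => [v|[e j]] /=; first by move=> _; exact: compact_set1.
move=> /arcs[[ec _] _]; apply: (arc_image_compact ec); first by rewrite divr_ge0.
by rewrite ler_pdivrMr // mul1r ler_nat.
Qed.

Lemma drawing_scale (R : realType) (T : finType) (G : sgraph T) pos arc :
  @plane_drawing R T G pos arc ->
  exists2 d : R, 0 < d & forall i j, drawn G i -> drawn G j ->
    piece pos arc i `&` piece pos arc j = set0 ->
    forall x y, piece pos arc i x -> piece pos arc j y -> ~ ball x d y.
Proof.
move=> D.
have : \forall d \near (0 : R)^'+, forall i j, drawn G i -> drawn G j ->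
    piece pos arc i `&` piece pos arc j = set0 ->
    forall x y, piece pos arc i x -> piece pos arc j y -> ~ ball x d y.
  apply: filter_forall => i; apply: filter_forall => j.
  case: (boolP (drawn G i)) => Gi; last by apply: nearW.
  case: (boolP (drawn G j)) => Gj; last by apply: nearW.
  case: (pselect (piece pos arc i `&` piece pos arc j = set0)) => ij; last by apply: nearW.
  have := compact_separated (piece_compact D Gi) (piece_compact D Gj) ij.
  by apply: filterS => d dP _ _ _; exact: dP.
move=> near_d; near ((0 : R)^'+) => d; exists d; first by near: d; exact: nbhs_right_gt.
by near: d.
Unshelve. all: by end_near. Qed.

Lemma drawing_bounded (R : realType) (T : finType) (G : sgraph T) pos arc :
  @plane_drawing R T G pos arc ->
  exists b : R, forall i x, drawn G i -> piece pos arc i x -> `|x.1| <= b /\ `|x.2| <= b.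
Proof.
move=> D.
have : \forall b \near (+oo : set_system R), forall i x, drawn G i ->
    piece pos arc i x -> `|x| <= b.
  apply: filter_forall => i; case: (boolP (drawn G i)) => Gi; last by apply: nearW.
  have bd : \forall b \near (+oo : set_system R), forall x, piece pos arc i x -> `|x| <= b.
    exact: compact_bounded (piece_compact D Gi).
  by apply: filterS bd => b bP x _; exact: bP.
move=> near_b; near (+oo : set_system R) => b.
have bP : forall i x, drawn G i -> piece pos arc i x -> `|x| <= b by near: b.
exists b => i x Gi ix; have := bP i x Gi ix.
by rewrite prod_normE ge_max => /andP.
Unshelve. all: by end_near. Qed.

Lemma drawing_uniform (R : realType) (T : finType) (G : sgraph T) pos arc (d : R) :
  @plane_drawing R T G pos arc -> 0 < d ->
  exists n, forall e, e \in edges G -> forall s t, s \in `[0, 1] -> t \in `[0, 1] ->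
    `|s - t| <= n.+1%:R^-1 -> ball (arc e s) d (arc e t).
Proof.
case=> _ arcs _ _ d0.
have : \forall n \near \oo, forall e, e \in edges G -> forall s t, s \in `[0, 1] ->
    t \in `[0, 1] -> `|s - t| <= n.+1%:R^-1 -> ball (arc e s) d (arc e t).
  apply: filter_forall => e; case: (boolP (e \in edges G)) => eG; last by apply: nearW.
  have [[ec _] _] := arcs e eG.
  by have := arc_uniform ec d0; apply: filterS => n nP _; exact: nP.
by case=> n _ nP; exists n => e eG; exact: (nP n (leqnn n) e eG).
Qed.

(** * Plane drawings give grid minors *)

(** The index of the interval of length d that contains x.  The shift makes the
    indices of all the points with coordinates bounded by b positive, so that
    row and column 0 stay empty. *)
Definition quant (R : realType) (b d x : R) : nat := Num.truncn ((x + b) / d + 1).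

Lemma quant_ge0 (R : realType) (b d x : R) :
  0 < d -> `|x| <= b -> 0 <= (x + b) / d.
Proof.
move=> d0; rewrite ler_norml => /andP[bx _].
by apply: divr_ge0; [lra|exact: ltW].
Qed.

Lemma quant_itv (R : realType) (b d x : R) :
  0 < d -> `|x| <= b ->
  (quant b d x)%:R <= (x + b) / d + 1 < (quant b d x).+1%:R.
Proof. by move=> d0 xb; rewrite truncn_itv // addr_ge0 ?quant_ge0. Qed.

Lemma quant_gt0 (R : realType) (b d x : R) : 0 < d -> `|x| <= b -> (0 < quant b d x)%N.
Proof.
move=> d0 xb; rewrite /quant truncn_ge_nat ?addr_ge0 ?quant_ge0 //.
by rewrite lerDr quant_ge0.
Qed.

Lemma quant_le (R : realType) (b d x : R) :
  0 < d -> `|x| <= b -> (quant b d x <= quant b d b)%N.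
Proof.
move=> d0 xb; have b0 : 0 <= b by exact: le_trans xb.
rewrite [quant b d b]/quant truncn_ge_nat; last by rewrite addr_ge0 ?quant_ge0 ?ger0_norm.
have /andP[/le_trans-> //] := quant_itv d0 xb.
by rewrite lerD2r ler_pM2r ?invr_gt0 // lerD2r; move: xb; rewrite ler_norml => /andP[].
Qed.

Lemma quant_eq (R : realType) (b d x y : R) :
  0 < d -> `|x| <= b -> `|y| <= b -> quant b d x = quant b d y -> `|x - y| < d.
Proof.
move=> d0 xb yb xy; have := quant_itv d0 xb; have := quant_itv d0 yb; rewrite xy.
set k := quant b d y; rewrite -natr1 => /andP[y1 y2] /andP[x1 x2].
have -> : x - y = ((x + b) / d - (y + b) / d) * d.
  by rewrite -mulrBl divfK ?gt_eqF // opprD addrACA subrr addr0.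
rewrite normrM (gtr0_norm d0) gtr_pMl // ltr_norml; apply/andP; split; lra.
Qed.

Lemma quant_close (R : realType) (b d x y : R) :
  0 < d -> `|x| <= b -> `|y| <= b -> `|x - y| < d ->
  [\/ quant b d x = quant b d y, quant b d x = (quant b d y).+1
    | quant b d y = (quant b d x).+1].
Proof.
move=> d0 xb yb; have := quant_itv d0 xb; have := quant_itv d0 yb.
have -> : x - y = ((x + b) / d - (y + b) / d) * d.
  by rewrite -mulrBl divfK ?gt_eqF // opprD addrACA subrr addr0.
rewrite normrM (gtr0_norm d0) gtr_pMl // ltr_norml.
set k := quant b d y; set l := quant b d x => /andP[y1 y2] /andP[x1 x2] /andP[xy1 xy2].
have kl : (k < l.+2)%N by rewrite -(ltr_nat R) -natr1; lra.
have lk : (l < k.+2)%N by rewrite -(ltr_nat R) -natr1; lra.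
move: kl lk; rewrite !ltnS; case: (ltngtP k l) => [kl|lk|->]; last by constructor 1.
  by move=> _ lk; constructor 2; apply/eqP; rewrite eqn_leq lk.
by move=> kl _; constructor 3; apply/eqP; rewrite eqn_leq kl.
Qed.

Lemma natr_ord_inj (N m n : nat) :
  (m < N.+2)%N -> (n < N.+2)%N -> m%:R = n%:R :> 'I_N.+2 -> m = n.
Proof.
move=> mN nN /(congr1 val); rewrite /= !Zp_nat /= !modn_small //.
Qed.

Lemma adjacent_fst (N m n : nat) (y : 'I_N.+2) :
  [\/ m = n, m = n.+1 | n = m.+1] -> adjacent (m%:R, y) (n%:R, y) (N := N).
Proof.
case=> ->; [by left|right; exists true|right; exists true].
  by right; rewrite /target /= natr1.
by left; rewrite /target /= natr1.
Qed.

Lemma adjacent_snd (N m n : nat) (x : 'I_N.+2) :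
  [\/ m = n, m = n.+1 | n = m.+1] -> adjacent (x, m%:R) (x, n%:R) (N := N).
Proof.
case=> ->; [by left|right; exists false|right; exists false].
  by right; rewrite /target /= natr1.
by left; rewrite /target /= natr1.
Qed.

(** The star of a vertex v consists of v and of the outer thirds next to it. *)
Definition belongs (T : finType) (tail head : {set T} -> T)
    (i : T + {set T} * 'I_3) (v : T) : Prop :=
  match i with
  | inl u => u = v
  | inr (e, j) => j = 0 /\ tail e = v \/ j = ord_max /\ head e = v
  end.

Lemma third_end (R : realType) (T : finType) (tail head : {set T} -> T) e (j : 'I_3)
    (t : R) v w :
  third j t -> at_end tail head e t w -> belongs tail head (inr (e, j)) v -> v = w.
Proof.
rewrite /third /= in_itv /= => tj [[t0 <-]|[t1 <-]] [[j0 <-]|[j2 <-]] //.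
  by exfalso; move: tj; rewrite t0 j2 /=; lra.
by exfalso; move: tj; rewrite t1 j0 /=; lra.
Qed.

Lemma middle_end (R : realType) (T : finType) (tail head : {set T} -> T) e (t : R) w :
  third (1 : 'I_3) t -> ~ at_end tail head e t w.
Proof.
rewrite /third /= in_itv /= => tj [[t0 _]|[t1 _]]; move: tj;
  rewrite ?t0 ?t1 /= modn_small //; lra.
Qed.

(** The stars of distinct vertices are disjoint: arcs meet only at their ends,
    and an outer third contains only one end. *)
Lemma pieces_disjoint (R : realType) (T : finType) (G : sgraph T) pos arc tail head :
  @plane_drawing R T G pos arc ->
  oriented_by G pos arc tail head ->
  forall i j u v x, drawn G i -> drawn G j ->
  belongs tail head i u -> belongs tail head j v ->
  piece pos arc i x -> piece pos arc j x -> u = v.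
Proof.
move=> D ends [a|[e j]] [b|[f k]] u v x iG jG.
- by move=> /= <- <- -> ab; case: D => pos_inj _ _ _; exact: pos_inj.
- move=> /= <- bv -> [t tk ftx].
  exact: esym (third_end tk (drawing_vertex D ends jG (third_unit tk) ftx) bv).
- move=> bu /= <- [t tj etx] xb; rewrite xb in etx.
  exact: third_end tj (drawing_vertex D ends iG (third_unit tj) etx) bu.
move=> bu bv [s sj <-] [t tk] /esym est.
have := drawing_meet D ends iG jG (third_unit sj) (third_unit tk) est.
case=> [[ef st]|[w [ew fw]]]; last first.
  by rewrite (third_end sj ew bu) (third_end tk fw bv).
move: bu bv sj tk; rewrite -ef -st /third /= !in_itv /=.
by case=> [[-> <-]|[-> <-]] [[-> <-]|[-> <-]] //= sj tk; exfalso; move: sj tk => /=; lra.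
Qed.

Lemma middle_disjoint (R : realType) (T : finType) (G : sgraph T) pos arc tail head :
  @plane_drawing R T G pos arc ->
  oriented_by G pos arc tail head ->
  forall e i v x, e \in edges G -> drawn G i -> belongs tail head i v ->
  piece pos arc (inr (e, 1)) x -> piece pos arc i x -> v \in e.
Proof.
move=> D ends e [b|[f k]] v x eG iG.
  move=> _ [t tj etx] xb; rewrite xb in etx.
  by case: (middle_end tj (drawing_vertex D ends eG (third_unit tj) etx)).
move=> bv [s sj <-] [t tk] /esym est.
have := drawing_meet D ends eG iG (third_unit sj) (third_unit tk) est.
case=> [[ef st]|[w [ew _]]]; last by case: (middle_end sj ew).
have [eE _ _] := ends e eG.
by rewrite eE !inE; case: bv; rewrite -ef => -[_ ->]; rewrite eqxx ?orbT.
Qed.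

Lemma middles_disjoint (R : realType) (T : finType) (G : sgraph T) pos arc tail head :
  @plane_drawing R T G pos arc ->
  oriented_by G pos arc tail head ->
  forall e f x, e \in edges G -> f \in edges G ->
  piece pos arc (inr (e, 1)) x -> piece pos arc (inr (f, 1)) x -> e = f.
Proof.
move=> D ends e f x eG fG [s sj <-] [t tk] /esym est.
have := drawing_meet D ends eG fG (third_unit sj) (third_unit tk) est.
by case=> [[ef st]|[w [ew _]]] //; case: (middle_end sj ew).
Qed.

(** Each arc is sampled at 3 m + 1 points so close that the indices of
    consecutive points differ by at most one in each coordinate.  The walk of an
    edge changes the two coordinates alternately, so its odd steps combine the
    abscissa of one sample with the ordinate of the previous one. *)
Lemma planar_grid_minor (R : realType) (T : finType) (G : sgraph T) :
  (0 < #|T|)%N -> planar R G ->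
  exists N, exists phi : cell N -> option T, grid_minor G phi.
Proof.
move=> /card_gt0P[x0 _] [pos [arc D]].
have [tail [head ends]] := drawing_ends D x0.
have [d0 d0_gt0 sep] := drawing_scale D.
have [b bound] := drawing_bounded D.
pose d := d0 / 3; have d_gt0 : 0 < d by rewrite /d; lra.
have [n unif] := drawing_uniform D d_gt0.
pose m := n.+1; pose g := quant b d; pose K := g b.
pose q e j := arc e (j%:R / (3 * m)%:R).
pose home v : cell K := ((g (pos v).1)%:R, (g (pos v).2)%:R).
pose W e i j : cell K := ((g (q e i).1)%:R, (g (q e j).2)%:R).
pose walk e k := W e (uphalf k) k./2.
exists K.
have posb v : `|(pos v).1| <= b /\ `|(pos v).2| <= b by exact: (bound (inl v)).
have m3 : 0 < (3 * m)%:R :> R by rewrite ltr0n.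
have param (j : nat) (k : 'I_3) : (k * m <= j <= k.+1 * m)%N -> @third R k (j%:R / (3 * m)%:R).
  move=> /andP[kj jk]; rewrite /third /= in_itv /= ler_pdivlMr // ler_pdivrMr //.
  have : (k * m)%:R <= j%:R :> R by rewrite ler_nat.
  have : j%:R <= (k.+1 * m)%:R :> R by rewrite ler_nat.
  by rewrite !natrM; lra.
have qpiece e j (k : 'I_3) : (k * m <= j <= k.+1 * m)%N -> piece pos arc (inr (e, k)) (q e j).
  by move=> jk; exists (j%:R / (3 * m)%:R) => //; exact: param.
have third_of k : (k <= 3 * (2 * m))%N -> exists l : 'I_3,
    (l * m <= k./2 <= l.+1 * m)%N && (l * m <= uphalf k <= l.+1 * m)%N.
  move=> k6; have [k2|k2] := leqP k (2 * m)%N; first by exists 0; rewrite /=; lia.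
  have [k4|k4] := leqP k (4 * m)%N; first by exists 1; rewrite /= modn_small //; lia.
  by exists ord_max; rewrite /=; lia.
have qb e j : e \in edges G -> (j <= 3 * m)%N -> `|(q e j).1| <= b /\ `|(q e j).2| <= b.
  move=> eG jm; have [l /andP[_ jl]] : exists l : 'I_3,
    (l * m <= j.*2./2 <= l.+1 * m)%N && (l * m <= uphalf j.*2 <= l.+1 * m)%N.
    by apply: third_of; lia.
  by apply: (bound (inr (e, l))) => //; apply: qpiece; move: jl; rewrite uphalf_double.
have qstep e j : e \in edges G -> (j < 3 * m)%N -> ball (q e j) d (q e j.+1).
  have punit i : (i <= 3 * m)%N -> i%:R / (3 * m)%:R \in `[(0 : R), 1].
    by move=> im; rewrite in_itv /= divr_ge0 // ler_pdivrMr // mul1r ler_nat.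
  move=> eG jm; apply: unif => //; try by apply: punit; lia.
  rewrite -mulrBl -natr1 opprD addrA subrr sub0r mulN1r normrN ger0_norm ?invr_ge0 //.
  by rewrite lef_pV2 ?posrE ?ltr0n // ler_nat; lia.
have gpos x : `|x| <= b -> (g x)%:R != 0 :> 'I_K.+2.
  move=> xb; apply/eqP => gx0; have := @natr_ord_inj K (g x) 0.
  have := quant_gt0 d_gt0 xb; rewrite -/(g x); have := quant_le d_gt0 xb.
  rewrite -/(g x) -/(g b) -/K => gK g0 /(_ _ _ gx0) gE.
  by move: g0; rewrite gE //; exact: leqW.
have ginj x y : `|x| <= b -> `|y| <= b -> (g x)%:R = (g y)%:R :> 'I_K.+2 -> ball x d y.
  move=> xb yb gxy; apply: (quant_eq d_gt0 xb yb); apply: natr_ord_inj gxy.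
    exact: leq_ltn_trans (quant_le d_gt0 xb) (leqnSn _).
  exact: leq_ltn_trans (quant_le d_gt0 yb) (leqnSn _).
(* A cell of the walk mixes two samples x and x' at distance less than d.  Two
   points near the same cell have abscissas within d and ordinates within 3 d,
   whence the choice of d as a third of the distance between pieces. *)
pose near_cell (p : cell K) (x : R * R) := exists x', [/\ ball x d x', `|x.1| <= b,
  `|x'.2| <= b, p.1 = (g x.1)%:R & p.2 = (g x'.2)%:R].
have near_ball p x y : near_cell p x -> near_cell p y -> ball x d0 y.
  move=> [x' [xx' x1 x2 p1 p2]] [y' [yy' y1 y2 p1' p2']].
  have d0E : d0 = d + d + d by rewrite /d; lra.
  have d0d : d <= d0 by rewrite d0E; lra.
  split; first by apply: (le_ball d0d); apply: ginj; rewrite -?p1 -?p1'.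
  rewrite d0E; apply: (@ball_triangle _ _ y'.2); last by apply: ball_sym; case: yy'.
  by apply: (@ball_triangle _ _ x'.2); [case: xx'|apply: ginj; rewrite -?p2 -?p2'].
have near_home v : near_cell (home v) (pos v).
  by have [? ?] := posb v; exists (pos v); split=> //; exact: ballxx.
have near_walk e k (l : 'I_3) : e \in edges G -> (2 * l * m <= k <= 2 * l.+1 * m)%N ->
    exists2 x, piece pos arc (inr (e, l)) x & near_cell (walk e k) x.
  move=> eG kl; exists (q e (uphalf k)); first by apply: qpiece; lia.
  have l3 := ltn_ord l; have k6 : (k <= 3 * (2 * m))%N by nia.
  have [q1 _] := qb e (uphalf k) eG (ltac:(lia)).
  have [_ q2] := qb e k./2 eG (ltac:(lia)).
  exists (q e k./2); split=> //; apply: ball_sym.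
  have : (uphalf k = k./2 \/ uphalf k = k./2.+1 /\ k./2 < 3 * m)%N by lia.
  by case=> [->|[-> km]]; [exact: ballxx|exact: qstep].
have apart i j p x y : drawn G i -> drawn G j -> piece pos arc i x -> piece pos arc j y ->
    near_cell p x -> near_cell p y -> exists z, piece pos arc i z /\ piece pos arc j z.
  move=> iG jG ix jy px py; apply: contrapT => no.
  apply: (sep i j iG jG _ x y ix jy (near_ball _ _ _ px py)).
  by rewrite -subset0 => z [iz jz]; apply: no; exists z.
have near_branch v p : (p = home v \/ exists e k, [/\ e \in edges G, p = walk e k
       & (k <= 2 * m)%N /\ tail e = v \/ (2 * (2 * m) <= k <= 3 * (2 * m))%N /\ head e = v]) ->
    exists i x, [/\ drawn G i, belongs tail head i v, piece pos arc i x & near_cell p x].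
  case=> [->|[e [k [eG -> kv]]]]; first by exists (inl v), (pos v); split.
  case: kv => -[km <-].
    have [|x ex nx] := near_walk e k 0 eG; first by rewrite /=; lia.
    by exists (inr (e, 0)), x; split=> //; left.
  have [|x ex nx] := near_walk e k ord_max eG; first by rewrite /=; lia.
  by exists (inr (e, ord_max)), x; split=> //; right.
have near_middle e p : e \in edges G ->
    (exists2 k, (2 * m <= k <= 2 * (2 * m))%N & p = walk e k) ->
    exists2 x, piece pos arc (inr (e, 1)) x & near_cell p x.
  by move=> eG [k km ->]; apply: near_walk => //; rewrite /= modn_small //; lia.
apply: (@grid_minor_of_walks _ G K (2 * m) tail head home walk).
- by move=> e /ends[].
- move=> e k eG k6; have [k0|k0] := boolP (odd k).
    have -> : walk e k = W e (uphalf k) k./2 by [].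
    have -> : walk e k.+1 = W e (uphalf k) k./2.+1 by congr W; lia.
    have [_ q1] := qb e k./2 eG (ltac:(lia)).
    have [_ q2] := qb e k./2.+1 eG (ltac:(lia)).
    apply: adjacent_snd; apply: (quant_close d_gt0 q1 q2).
    by case: (qstep e k./2 eG (ltac:(lia))).
  have -> : walk e k = W e k./2 k./2 by congr W; lia.
  have -> : walk e k.+1 = W e k./2.+1 k./2 by congr W; lia.
  have [q1 _] := qb e k./2 eG (ltac:(lia)).
  have [q2 _] := qb e k./2.+1 eG (ltac:(lia)).
  apply: adjacent_fst; apply: (quant_close d_gt0 q1 q2).
  by case: (qstep e k./2 eG (ltac:(lia))).
- move=> e eG; have [_ e0 _] := ends e eG.
  by rewrite /walk /W /q /= mul0r e0.
- move=> e eG; have [_ _ e1] := ends e eG.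
  have -> : walk e (3 * (2 * m))%N = W e (3 * m)%N (3 * m)%N by congr W; lia.
  by rewrite /W /q divff ?gt_eqF // e1.
- by move=> v; have [v1 v2] := posb v; split; exact: gpos.
- move=> e k eG k6; split; apply: gpos.
    by have [] := qb e (uphalf k) eG (ltac:(lia)).
  by have [] := qb e k./2 eG (ltac:(lia)).
- move=> u v p /near_branch[i [x [iG iu ix px]]] /near_branch[j [y [jG jv jy py]]].
  have [z [iz jz]] := apart i j p x y iG jG ix jy px py.
  exact: (pieces_disjoint D ends iG jG iu jv iz jz).
- move=> e v p eG /(near_middle e p eG)[x ex px] /near_branch[j [y [jG jv jy py]]].
  have [z [ez jz]] := apart (inr (e, 1)) j p x y eG jG ex jy px py.
  exact: (middle_disjoint D ends eG jG jv ez jz).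
- move=> e f p eG fG /(near_middle e p eG)[x ex px] /(near_middle f p fG)[y fy py].
  have [z [ez fz]] := apart (inr (e, 1)) (inr (f, 1)) p x y eG fG ex fy px py.
  exact: (middles_disjoint D ends eG fG ez fz).
Qed.

(** * The upper bound *)

Lemma planar_C4_free_bound (R : realType) (T : finType) (G : sgraph T) :
  (3 < #|T|)%N -> planar R G -> subgraph_free C4 G ->
  (7 * #|edges G| <= 15 * (#|T| - 2))%N.
Proof.
move=> T_gt3 plG free; have T_gt0 : (0 < #|T|)%N by lia.
have [N [phi /minor_two_basis[B ZB colB]]] := planar_grid_minor T_gt0 plG.
exact: edge_bound T_gt3 free ZB colB.
Qed.

(** * The tube *)

(** The vertices are numbered from the inner cap outwards, ring after ring.  The
    entry x of the list [links k] below contains the numbers d such that x is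
    adjacent to x + d, so that it does not depend on the position of x in the
    numbering and the 70 entries of a band can be repeated.  The cap is the
    innermost pentagon of edges of Q followed by its five spokes; a band covers
    six rings, with ten of the vertices of S.  No vertex of S lies on
    the first ring of a band, so that a lid can start with the same ring, and
    the links that leave the cap or a band fit both. *)
Definition cap_links : seq (seq nat) :=
  [:: [:: 1; 4; 5; 6]; [:: 1; 5; 6]; [:: 1; 5; 6]; [:: 1; 5; 6]; [:: 1; 5];
    [:: 5; 14]; [:: 5; 6]; [:: 6; 7]; [:: 7; 8]; [:: 8; 9]].

Definition band_links : seq (seq nat) :=
  [:: [:: 1; 9; 10]; [:: 1; 9]; [:: 1; 9]; [:: 1; 8]; [:: 1; 8]; [:: 1; 7];
    [:: 1; 7]; [:: 1; 6]; [:: 1; 6]; [:: 5]; [:: 5; 8; 9; 10]; [:: 4; 5];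
    [:: 4; 5; 9; 10]; [:: 4; 10]; [:: 4; 9]; [:: 1; 5]; [:: 5]; [:: 5; 6];
    [:: 1; 5]; [:: 5; 12]; [:: 5; 13]; [:: 5; 12]; [:: 5; 6]; [:: 6; 7];
    [:: 1; 7; 8]; [:: 7; 8]; [:: 1; 7; 8]; [:: 1; 7]; [:: 1; 7]; [:: 1; 6];
    [:: 1; 6]; [:: 5]; [:: 5; 11]; [:: 5; 6]; [:: 6; 7]; [:: 6; 7; 11; 12];
    [:: 6; 7]; [:: 1; 6; 7]; [:: 1; 6]; [:: 1; 6]; [:: 1; 5]; [:: 5];
    [:: 1; 5]; [:: 5; 12]; [:: 5; 6]; [:: 5; 6; 12; 13]; [:: 5; 6]; [:: 6; 7];
    [:: 1; 7; 8]; [:: 1; 7]; [:: 7]; [:: 1; 7]; [:: 1; 7]; [:: 1; 6];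
    [:: 1; 6]; [:: 5]; [:: 5; 10]; [:: 5; 9]; [:: 5; 10]; [:: 5; 9];
    [:: 1; 4; 5; 9]; [:: 4; 5]; [:: 1; 4; 5]; [:: 4; 5]; [:: 4; 5]; [:: 5; 14];
    [:: 5; 6]; [:: 6; 7]; [:: 7; 8]; [:: 8; 9]].

Definition lid_links : seq (seq nat) :=
  [:: [:: 1; 9; 10]; [:: 1; 9]; [:: 1; 9]; [:: 1; 8]; [:: 1; 8]; [:: 1; 7];
    [:: 1; 7]; [:: 1; 6]; [:: 1; 6]; [:: 5]; [:: 5; 6]; [:: 5; 6]; [:: 5; 6];
    [:: 5; 6]; [:: 1; 5]; [:: 1; 4]; [:: 1]; [:: 1]; [:: 1]; [::]].

(** The coordinates were found by placing each vertex of the periodic tube at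
    the barycentre of its neighbours, on a cylinder with coordinates the angle
    and the logarithm of the radius, and by rounding the image in the plane;
    what matters of them is checked by computation. *)
Definition cap_points : seq (Z * Z) :=
  [:: (30, 27); (-16, 37); (-40, -4); (-9, -39); (35, -20); (54, 4); (11, 51);
    (-47, 27); (-39, -36); (22, -48)]%ZZ.

Definition band_points : seq (Z * Z) :=
  [:: (70, 27); (37, 61); (-6, 67); (-47, 54); (-74, 16); (-66, -29); (-32, -60);
    (11, -69); (47, -54); (70, -20); (86, 76); (-36, 84); (-116, -10);
    (-10, -96); (80, -57); (-4, 121); (-86, 87); (-64, -110); (124, -26);
    (162, 34); (37, 165); (-145, 89); (-138, -98); (58, -127); (205, 101);
    (106, 210); (-224, 75); (-220, -79); (-129, -202); (24, -226); (152, -153);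
    (221, -31); (252, 190); (-97, 231); (-310, -27); (-76, -359); (279, -125);
    (244, 330); (-27, 384); (-268, 303); (-417, 80); (-347, -196); (268, -303);
    (444, 40); (108, 515); (-567, 322); (-360, -374); (159, -512); (614, 296);
    (315, 625); (-140, 679); (-654, -236); (-390, -600); (12, -732);
    (471, -594); (702, -162); (649, 712); (-401, 874); (-960, -98);
    (-320, -937); (998, -610); (1176, 509); (-835, 1050); (-1331, 201);
    (111, -1283); (1700, -22); (290, 1378); (-1538, 897); (-1065, -945);
    (797, -1466)]%ZZ.

Definition lid_points : seq (Z * Z) :=
  [:: (70, 27); (37, 61); (-6, 67); (-47, 54); (-74, 16); (-66, -29); (-32, -60);
    (11, -69); (47, -54); (70, -20); (73, 63); (-38, 86); (-96, -10);
    (-18, -92); (82, -50); (126, 13); (27, 124); (-110, 64); (-95, -85);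
    (51, -116)]%ZZ.

Definition links (k : nat) : seq (seq nat) :=
  cap_links ++ flatten (nseq k band_links) ++ lid_links.

(** The factor 32 per band leaves room for six rings with straight edges. *)
Definition scale (p : Z * Z) : Z * Z := (32 * p.1, 32 * p.2)%ZZ.

Fixpoint tail_points (k : nat) : seq (Z * Z) :=
  if k is k'.+1 then band_points ++ map scale (tail_points k') else lid_points.

Definition points (k : nat) : seq (Z * Z) := cap_points ++ tail_points k.

Definition up (k x : nat) : seq nat := nth [::] (links k) x.
Definition point (k x : nat) : Z * Z := nth (0, 0)%ZZ (points k) x.

(** * Separation of segments by lines *)

Definition form (A B C : Z) (p : Z * Z) : Z := (A * p.1 + B * p.2 + C)%ZZ.

(** An affine form is nonpositive on ab and nonnegative on cd, and vanishes on at
    most one of the two segments.  The open segments are then disjoint, even if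
    the closed ones share an end. *)
Definition sep (a b c d : Z * Z) : Prop :=
  exists A B C, [/\ (form A B C a <= 0)%ZZ, (form A B C b <= 0)%ZZ,
    (0 <= form A B C c)%ZZ, (0 <= form A B C d)%ZZ &
    (form A B C a < 0 \/ form A B C b < 0 \/ 0 < form A B C c \/ 0 < form A B C d)%ZZ].

Definition orient (a b c : Z * Z) : Z :=
  ((b.1 - a.1) * (c.2 - a.2) - (b.2 - a.2) * (c.1 - a.1))%ZZ.

(** The points c and d are on one side of the line ab, and not both on it.  For
    two segments without common inner point that are not on one line, this
    holds for the line of one of them. *)
Definition one_sided (a b c d : Z * Z) : bool :=
  match Z.compare (orient a b c) 0, Z.compare (orient a b d) 0 with
  | Lt, Gt | Gt, Lt | Eq, Eq => false
  | _, _ => true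
  end.

Definition sepb (a b c d : Z * Z) : bool :=
  if one_sided a b c d then true else one_sided c d a b.

(** * Computed checks for at most two bands *)

Definition segments (k : nat) : seq ((nat * nat) * ((Z * Z) * (Z * Z))) :=
  let P := points k in
  [seq ((x, d), (nth (0, 0)%ZZ P x, nth (0, 0)%ZZ P (x + d)%N))
  | x <- iota 0 (30 + 70 * k), d <- up k x].

(** The conditionals of these checks, unlike the boolean connectives, spare the
    comparison of indices when the geometric test succeeds. *)
Definition segments_ok (k : nat) : bool :=
  let S := segments k in
  all (fun s => all (fun t => if sepb s.2.1 s.2.2 t.2.1 t.2.2 then true else s.1 == t.1) S) S.

Definition vertices_ok (k : nat) : bool :=
  let S := segments k in
  let V := zip (iota 0 (30 + 70 * k)) (points k) in
  all (fun s => all (fun v =>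
    if Z.eqb (orient s.2.1 s.2.2 v.2) 0 then (v.1 == s.1.1) || (v.1 == s.1.1 + s.1.2)%N
    else true) V) S.

(** Both points are beyond the same side of the square of half-side 300, hence
    so is the segment between them. *)
Definition outer (p q : Z * Z) : bool :=
  [|| (300 <? p.1) && (300 <? q.1), (p.1 <? -300) && (q.1 <? -300),
      (300 <? p.2) && (300 <? q.2) | (p.2 <? -300) && (q.2 <? -300)]%ZZ.

(** The number 66 is 136 - 70, see [local_ind]. *)
Definition outer_ok (k : nat) : bool :=
  all (fun s => if outer s.2.1 s.2.2 then true else (s.1.1 < 66)%N) (segments k) &&
  all (fun v => if outer v.2 v.2 then true else (v.1 < 66)%N)
    (zip (iota 0 (30 + 70 * k)) (points k)).

Definition neighbours (k x : nat) : seq nat :=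
  [seq x + d | d <- up k x]%N ++ [seq y <- iota (x - 14) (minn 14 x) | (x - y)%N \in up k y].

Definition squares_ok (k : nat) : bool :=
  all (fun x => let N := neighbours k x in
    all (fun y => let M := neighbours k y in
      all (fun z => if y == z then true else
         all (fun w => (w == x) || (w \notin neighbours k z)) M) N) N) (iota 0 (30 + 70 * k)).

Lemma base_ok : all (fun k => [&& segments_ok k, vertices_ok k, outer_ok k & uniq (points k)])
  [:: 0; 1; 2]%N.
Proof. by vm_cast_no_check (erefl true). Qed.

Lemma squares_base : all squares_ok [:: 0; 1; 2]%N.
Proof. by vm_cast_no_check (erefl true). Qed.

(** * Shifting and truncating the tube *)

Arguments cap_links : simpl never.
Arguments band_links : simpl never.
Arguments lid_links : simpl never.
Arguments cap_points : simpl never.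
Arguments band_points : simpl never.
Arguments lid_points : simpl never.

Lemma size_links k : size (links k) = (30 + 70 * k)%N.
Proof. rewrite /links !size_cat size_flatten /shape map_nseq sumn_nseq /=; lia. Qed.

Lemma size_tail_points k : size (tail_points k) = (20 + 70 * k)%N.
Proof. by elim: k => [|k IH] //=; rewrite size_map IH; lia. Qed.

Lemma size_points k : size (points k) = (30 + 70 * k)%N.
Proof. rewrite /points size_cat size_tail_points /=; lia. Qed.

Lemma tail_links k : flatten (nseq k.+1 band_links) ++ lid_links =
  band_links ++ (flatten (nseq k band_links) ++ lid_links).
Proof. by rewrite -catA. Qed.

Lemma flatten_nseqS (T : Type) (s : seq T) k :
  flatten (nseq k.+1 s) = flatten (nseq k s) ++ s.
Proof. by elim: k => [|k IH] /=; [rewrite cats0|rewrite -catA -IH]. Qed.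

Lemma nth_skip (T : Type) (x0 : T) (s1 s2 : seq T) m x :
  (size s1 = m)%N -> nth x0 (s1 ++ s2) (m + x) = nth x0 s2 x.
Proof. by move=> <-; rewrite nth_cat ltnNge leq_addr /= addKn. Qed.

(** Removing the first band renumbers the vertices beyond the cap. *)
Lemma up_shift k x : (10 <= x)%N -> up k.+1 (x + 70) = up k x.
Proof.
move=> /subnKC <-; set y := (x - 10)%N; rewrite /up /links tail_links.
rewrite -addnA (nth_skip _ _ _ (erefl : size cap_links = 10%N)) addnC.
rewrite !(nth_skip _ _ _ (erefl : size cap_links = 10%N)).
by rewrite (nth_skip _ _ _ (erefl : size band_links = 70%N)).
Qed.

(** Removing the last band changes nothing before it. *)
Lemma up_prefix k x : (x < 10 + 70 * k)%N -> up k.+1 x = up k x.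
Proof.
move=> xk; rewrite /up /links flatten_nseqS -!catA !catA -(catA _ _ lid_links) !nth_cat.
have -> : size (cap_links ++ flatten (nseq k band_links)) = (10 + 70 * k)%N.
  by rewrite size_cat size_flatten /shape map_nseq sumn_nseq.
by rewrite xk.
Qed.

Lemma point_shift k x : (10 <= x)%N -> point k.+1 (x + 70) = scale (point k x).
Proof.
move=> /subnKC <-; set y := (x - 10)%N; rewrite /point /points.
rewrite [tail_points k.+1]/(band_points ++ map scale (tail_points k)).
rewrite -addnA !(nth_skip _ _ _ (erefl : size cap_points = 10%N)) addnC.
rewrite (nth_skip _ _ _ (erefl : size band_points = 70%N)).
have [yk|yk] := ltnP y (size (tail_points k)); first by rewrite (nth_map (0, 0)%ZZ).
by rewrite !nth_default ?size_map.
Qed.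

Lemma point_prefix k x : (x < 10 + 70 * k)%N -> point k.+1 x = point k x.
Proof.
have tail m y : (y < 70 * m)%N ->
    nth (0, 0)%ZZ (tail_points m.+1) y = nth (0, 0)%ZZ (tail_points m) y.
  elim: m y => [|m IH] y ym; first by lia.
  change (nth (0, 0)%ZZ (band_points ++ map scale (tail_points m.+1)) y =
    nth (0, 0)%ZZ (band_points ++ map scale (tail_points m)) y).
  rewrite !nth_cat (erefl : size band_points = 70%N); case: ltnP => // y70.
  rewrite (nth_map (0, 0)%ZZ) ?size_tail_points; last by lia.
  rewrite (nth_map (0, 0)%ZZ) ?size_tail_points; last by lia.
  by rewrite IH //; lia.
have pointE m : point m x =
    if (x < 10)%N then nth (0, 0)%ZZ cap_points x else nth (0, 0)%ZZ (tail_points m) (x - 10).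
  by rewrite /point /points nth_cat.
by move=> xk; rewrite !pointE; case: ltnP => // x10; rewrite tail //; lia.
Qed.

Lemma all_up (P : pred (seq nat)) k x :
  all P cap_links -> all P band_links -> all P lid_links -> P [::] -> P (up k x).
Proof.
move=> Pcap Pband Plid Pnil; have Pk : all P (links k).
  rewrite /links !all_cat Pcap Plid andbT.
  elim: k => // k IH.
  rewrite (erefl : flatten (nseq k.+1 band_links) = band_links ++ flatten (nseq k band_links)).
  by rewrite all_cat Pband.
rewrite /up; have [xk|xk] := ltnP x (size (links k)); last by rewrite nth_default.
exact: (allP Pk) (mem_nth _ xk).
Qed.

Lemma up_bound k x d : d \in up k x -> (0 < d <= 14)%N.
Proof. by move: d; apply/allP/(all_up (P := all (fun d => 0 < d <= 14)%N)). Qed.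

Lemma up_uniq k x : uniq (up k x).
Proof. exact: all_up. Qed.

Lemma up_range k x d : d \in up k x -> (x + d < 30 + 70 * k)%N.
Proof.
elim: k x => [|k IH] x dx.
  have x30 : (x < 30)%N by rewrite ltnNge; apply: contraTN dx => x30; rewrite /up nth_default.
  have /allP/(_ x) : all (fun x => all (fun d => x + d < 30)%N (up 0 x)) (iota 0 30) by [].
  by rewrite mem_iota => /(_ x30)/allP; apply.
have [x80|x80] := ltnP x 80; first by have := up_bound dx; lia.
have xE : x = ((x - 70) + 70)%N by lia.
have dx' : d \in up k (x - 70) by rewrite -up_shift -?xE //; lia.
by have := IH _ dx'; lia.
Qed.

Lemma mem_segments k x d : d \in up k x ->
  ((x, d), (point k x, point k (x + d)))%N \in segments k.
Proof.
move=> dx; rewrite /segments.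
apply: (allpairs_f_dep (fun x d => ((x, d), (point k x, point k (x + d)%N)))) => //.
by rewrite mem_iota /=; have := up_range dx; lia.
Qed.

Lemma sep_sym a b c d : sep a b c d -> sep c d a b.
Proof.
case=> A [B [C]]; rewrite /form => -[? ? ? ? ?]; exists (- A)%ZZ, (- B)%ZZ, (- C)%ZZ.
by rewrite /form; split; lia.
Qed.

Lemma form_scale A B C p : form A B (32 * C)%ZZ (scale p) = (32 * form A B C p)%ZZ.
Proof. by rewrite /form /scale; cbn [fst snd]; ring. Qed.

Lemma form_opp A B C p : form (- A)%ZZ (- B)%ZZ (- C)%ZZ p = (- form A B C p)%ZZ.
Proof. by rewrite /form; ring. Qed.

Lemma sep_scale a b c d : sep a b c d -> sep (scale a) (scale b) (scale c) (scale d).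
Proof.
by case=> A [B [C [? ? ? ? ?]]]; exists A, B, (32 * C)%ZZ; rewrite !form_scale; split; lia.
Qed.

(** * Straight edges of the tube do not cross *)

Definition off_segment (a b v : Z * Z) : Prop :=
  exists A B C, [/\ (form A B C a <= 0)%ZZ, (form A B C b <= 0)%ZZ & (0 < form A B C v)%ZZ].

Lemma off_segment_scale a b v :
  off_segment a b v -> off_segment (scale a) (scale b) (scale v).
Proof.
by case=> A [B [C [? ? ?]]]; exists A, B, (32 * C)%ZZ; rewrite !form_scale; split; lia.
Qed.

Lemma orient_form (a b : Z * Z) : exists A B C, forall p, orient a b p = form A B C p.
Proof.
exists (- (b.2 - a.2))%ZZ, (b.1 - a.1)%ZZ, ((b.2 - a.2) * a.1 - (b.1 - a.1) * a.2)%ZZ => p.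
by rewrite /orient /form; ring.
Qed.

Lemma orient_l a b : orient a b a = 0%ZZ. Proof. by rewrite /orient; ring. Qed.
Lemma orient_r a b : orient a b b = 0%ZZ. Proof. by rewrite /orient; ring. Qed.

Lemma one_sided_sep a b c d : one_sided a b c d -> sep a b c d.
Proof.
have [A [B [C oE]]] := orient_form a b.
have := orient_l a b; have := orient_r a b; rewrite /one_sided !oE => b0 a0 os.
have [pos|neg] : (0 <= form A B C c /\ 0 <= form A B C d /\
      (0 < form A B C c \/ 0 < form A B C d) \/
    form A B C c <= 0 /\ form A B C d <= 0 /\
      (form A B C c < 0 \/ form A B C d < 0))%ZZ.
  case: (Z.compare_spec (form A B C c) 0) os;
    case: (Z.compare_spec (form A B C d) 0) => //; lia.
- by exists A, B, C; split; lia.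
by exists (- A)%ZZ, (- B)%ZZ, (- C)%ZZ; rewrite !form_opp; split; lia.
Qed.

Lemma sepb_sep a b c d : sepb a b c d -> sep a b c d.
Proof.
rewrite /sepb; case: (boolP (one_sided a b c d)) => [os _|_ os]; first exact: one_sided_sep.
by apply/sep_sym/one_sided_sep.
Qed.

Lemma orient_off a b v : orient a b v <> 0%ZZ -> off_segment a b v.
Proof.
have [A [B [C oE]]] := orient_form a b.
have := orient_l a b; have := orient_r a b; rewrite !oE => b0 a0 v0.
have [vp|vn] : (0 < form A B C v \/ form A B C v < 0)%ZZ by lia.
- by exists A, B, C; split; lia.
by exists (- A)%ZZ, (- B)%ZZ, (- C)%ZZ; rewrite !form_opp; split; lia.
Qed.

Definition beyond (r : Z) (p q : Z * Z) : Prop :=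
  (r < p.1 /\ r < q.1 \/ p.1 < - r /\ q.1 < - r \/
   r < p.2 /\ r < q.2 \/ p.2 < - r /\ q.2 < - r)%ZZ.

Definition within_box (r : Z) (p : Z * Z) : Prop := (Z.abs p.1 <= r /\ Z.abs p.2 <= r)%ZZ.

Lemma outer_beyond p q : outer p q -> beyond 300%ZZ p q.
Proof. by rewrite /outer /beyond => /or4P[] /andP[]; lia. Qed.

Lemma beyond_scale p q : beyond 300%ZZ p q -> beyond 9600%ZZ (scale p) (scale q).
Proof. by rewrite /beyond /scale; cbn [fst snd]; lia. Qed.

Lemma beyond_weaken p q : beyond 9600%ZZ p q -> beyond 300%ZZ p q.
Proof. by rewrite /beyond; lia. Qed.

(** A side of a square separates what is inside from a segment beyond it. *)
Lemma box_sep r a b c d : within_box r a -> within_box r b -> beyond r c d ->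
  [/\ sep a b c d, off_segment a b c & off_segment c d a].
Proof.
rewrite /within_box /beyond => -[a1 a2] [b1 b2] cd.
have [A [B [ra [rb [rc rd]]]]] : exists A B : Z,
    (A * a.1 + B * a.2 <= r /\ A * b.1 + B * b.2 <= r /\
     r < A * c.1 + B * c.2 /\ r < A * d.1 + B * d.2)%ZZ.
  case: cd => [?|[?|[?|?]]];
    [exists 1%ZZ, 0%ZZ|exists (-1)%ZZ, 0%ZZ|exists 0%ZZ, 1%ZZ|exists 0%ZZ, (-1)%ZZ]; lia.
split.
- by exists A, B, (- r)%ZZ; rewrite /form; split; lia.
- by exists A, B, (- r)%ZZ; rewrite /form; split; lia.
- by exists (- A)%ZZ, (- B)%ZZ, (r + 1)%ZZ; rewrite /form; split; lia.
Qed.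

Lemma base_parts k : (k <= 2)%N ->
  [/\ segments_ok k, vertices_ok k, outer_ok k & uniq (points k)].
Proof.
move=> k2; have /allP/(_ k) := base_ok; rewrite !inE.
have -> : [|| k == 0, k == 1 | k == 2]%N by lia.
by move=> /(_ isT)/and4P[].
Qed.

(** The induction for properties of two links x -- x + d and y -- y + c.  Links
    have length at most 14.  If x and y are at least 80 = 10 + 70, the first
    band can be removed.  Otherwise one link, say at x, lies below 94 = 80 + 14.
    If the other one ends before the last band, which starts at 150 = 10 + 2 * 70
    or later as soon as there are three bands, then the last band can be removed;
    and if not, y is at least 136 = 150 - 14, and the links are far apart. *)
Lemma local_ind (P : nat -> nat -> nat -> nat -> nat -> Prop) :
  (forall k x d y c, (k <= 2)%N -> P k x d y c) ->
  (forall k x d y c, (10 <= x)%N -> (10 <= y)%N -> P k x d y c ->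
     P k.+1 (x + 70)%N d (y + 70)%N c) ->
  (forall k x d y c, (x + d < 10 + 70 * k)%N -> (y + c < 10 + 70 * k)%N ->
     P k x d y c -> P k.+1 x d y c) ->
  (forall k x d y c, (2 <= k)%N -> (x < 80)%N -> (136 <= y)%N -> P k x d y c) ->
  (forall k x d y c, (2 <= k)%N -> (136 <= x)%N -> (y < 80)%N -> P k x d y c) ->
  forall k x d y c, (d <= 14)%N -> (c <= 14)%N -> P k x d y c.
Proof.
move=> base shift prefix farr farl; elim=> [|k IH] x d y c d14 c14; first exact: base.
have [k2|k2] := leqP k.+1 2; first exact: base.
have [x80|x80] := ltnP x 80.
  have [y136|y136] := leqP 136 y; first by apply: farr => //; lia.
  by apply: prefix; [lia|lia|exact: IH].
have [y80|y80] := ltnP y 80.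
  have [x136|x136] := leqP 136 x; first by apply: farl => //; lia.
  by apply: prefix; [lia|lia|exact: IH].
rewrite -(subnK (leq_trans (isT : 70 <= 80)%N x80)) -(subnK (leq_trans (isT : 70 <= 80)%N y80)).
by apply: shift; [lia|lia|exact: IH].
Qed.

Lemma mem_vertices k x : (x < 30 + 70 * k)%N ->
  (x, point k x) \in zip (iota 0 (30 + 70 * k)) (points k).
Proof.
move=> xk; have sz : size (zip (iota 0 (30 + 70 * k)) (points k)) = (30 + 70 * k)%N.
  by rewrite size_zip size_iota size_points minnn.
have -> : (x, point k x) = nth (0%N, (0, 0)%ZZ) (zip (iota 0 (30 + 70 * k)) (points k)) x.
  by rewrite nth_zip ?size_iota ?size_points // nth_iota.
by rewrite mem_nth // sz.
Qed.

Lemma points_beyond k x d : (x < 30 + 70 * k)%N -> d = 0%N \/ d \in up k x -> (66 <= x)%N ->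
  beyond 300%ZZ (point k x) (point k (x + d)).
Proof.
elim: k x => [|k IH] x xk dx x66; first by lia.
have d14 : (d <= 14)%N by case: dx => [->|/up_bound]; lia.
have [k2|k2] := leqP k.+1 2.
  have [_ _ /andP[/allP sok /allP vok] _] := base_parts k2.
  apply: outer_beyond; case: dx => [->|dx].
    by have := vok _ (mem_vertices xk); rewrite /= addn0; case: ifP => //; lia.
  by have := sok _ (mem_segments dx); rewrite /=; case: ifP => //; lia.
have [x136|x136] := ltnP x 136.
  rewrite !point_prefix; [|lia|lia].
  by apply: IH => //; [lia|rewrite -up_prefix //; lia].
have xE : x = ((x - 70) + 70)%N by lia.
rewrite xE addnAC !point_shift; [|lia|lia].
apply/beyond_weaken/beyond_scale/IH; [lia| |lia].
by rewrite -up_shift -?xE //; lia.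
Qed.

(** Removing the first band turns 136 into 66 and the square of half-side 9600
    into that of half-side 300. *)
Lemma points_far k x d : (2 <= k)%N -> (x < 30 + 70 * k)%N -> d = 0%N \/ d \in up k x ->
  (136 <= x)%N -> beyond 9600%ZZ (point k x) (point k (x + d)).
Proof.
case: k => // k k1 xk dx x136.
have xE : x = ((x - 70) + 70)%N by lia.
rewrite xE addnAC !point_shift; [|lia|lia].
apply/beyond_scale/points_beyond; [lia| |lia].
by rewrite -up_shift -?xE //; lia.
Qed.

Lemma points_near k x : (2 <= k)%N -> (x < 94)%N -> within_box 9600%ZZ (point k x).
Proof.
elim: k => // k IH k1 x94.
have [k2|k2] := ltnP 1 k; first by rewrite point_prefix; [exact: IH|lia].
have -> : k.+1 = 2%N by lia.
have /allP/(_ x) : all (fun x =>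
    (Z.abs (point 2 x).1 <=? 9600) && (Z.abs (point 2 x).2 <=? 9600))%ZZ (iota 0 94).
  by vm_compute.
by rewrite mem_iota /= => /(_ x94)/andP[]; rewrite /within_box; lia.
Qed.

Lemma edges_sep k x d y c : d \in up k x -> c \in up k y -> (x, d) != (y, c) ->
  sep (point k x) (point k (x + d)) (point k y) (point k (y + c)).
Proof.
move=> dx cy; have /andP[_ d14] := up_bound dx; have /andP[_ c14] := up_bound cy.
move: dx cy; move: k x d y c d14 c14; apply: local_ind.
- move=> k x d y c k2 dx cy neq; have [/allP sok _ _ _] := base_parts k2.
  have /allP/(_ _ (mem_segments cy)) := sok _ (mem_segments dx).
  by rewrite /= (negPf neq); case: ifP => // /sepb_sep.
- move=> k x d y c x10 y10 IH; rewrite !up_shift // => dx cy neq.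
  rewrite !(addnAC _ 70) !point_shift //; try by lia.
  apply/sep_scale/IH => //; apply: contra_neq neq => -[-> ->] //.
- move=> k x d y c xd yc IH.
  have xk := leq_ltn_trans (leq_addr _ _) xd; have yk := leq_ltn_trans (leq_addr _ _) yc.
  by rewrite !up_prefix // !point_prefix.
- move=> k x d y c k2 x80 y136 dx cy _.
  have := up_bound dx; have := up_range cy => yn d14.
  by case: (@box_sep 9600%ZZ (point k x) (point k (x + d)) (point k y) (point k (y + c)));
    [apply: points_near; lia|apply: points_near; lia|apply: points_far => //; [lia|right]|].
- move=> k x d y c k2 x136 y80 dx cy _; apply: sep_sym.
  have := up_bound cy; have := up_range dx => yn d14.
  by case: (@box_sep 9600%ZZ (point k y) (point k (y + c)) (point k x) (point k (x + d)));
    [apply: points_near; lia|apply: points_near; lia|apply: points_far => //; [lia|right]|].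
Qed.

Lemma vertex_off k x d y : d \in up k x -> (y < 30 + 70 * k)%N -> y != x -> y != (x + d)%N ->
  off_segment (point k x) (point k (x + d)) (point k y).
Proof.
suff H : forall k x d y c, (d <= 14)%N -> (c <= 14)%N -> d \in up k x -> (y < 30 + 70 * k)%N ->
    y != x -> y != (x + d)%N -> off_segment (point k x) (point k (x + d)) (point k y).
  by move=> dx; apply: (H k x d y 0%N) => //; case/andP: (up_bound dx).
apply: local_ind => {k x d y}.
- move=> k x d y c k2 dx yn yx yd; have [_ /allP vok _ _] := base_parts k2.
  have /allP/(_ _ (mem_vertices yn)) := vok _ (mem_segments dx).
  rewrite /= (negPf yx) (negPf yd); case: ifP => // /Z.eqb_neq o0 _.
  exact: orient_off.
- move=> k x d y c x10 y10 IH; rewrite up_shift // => dx yn yx yd.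
  rewrite (addnAC _ 70) !point_shift //; try by lia.
  by apply/off_segment_scale/IH => //; lia.
- move=> k x d y c xd yc IH.
  have xk := leq_ltn_trans (leq_addr _ _) xd; have yk := leq_ltn_trans (leq_addr _ _) yc.
  by rewrite up_prefix // !point_prefix // => dx yn; apply: IH => //; lia.
- move=> k x d y c k2 x80 y136 dx yn _ _; have := up_bound dx => d14.
  have := points_far k2 yn (or_introl erefl) y136; rewrite addn0 => far.
  by case: (@box_sep 9600%ZZ (point k x) (point k (x + d)) (point k y) (point k y));
    [apply: points_near; lia|apply: points_near; lia|exact: far|].
- move=> k x d y c k2 x136 y80 dx yn _ _; have := up_range dx => xn.
  have xn' : (x < 30 + 70 * k)%N by lia.
  have far := points_far k2 xn' (or_intror dx) x136.
  by case: (@box_sep 9600%ZZ (point k y) (point k y) (point k x) (point k (x + d)));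
    [apply: points_near; lia|apply: points_near; lia|exact: far|].
Qed.

Lemma scale_inj : injective scale.
Proof.
move=> [a b] [c d]; rewrite /scale; cbn [fst snd] => /pair_equal_spec[e1 e2].
by apply/pair_equal_spec; split; lia.
Qed.

Lemma point_inj k x y : (x < 30 + 70 * k)%N -> (y < 30 + 70 * k)%N ->
  point k x = point k y -> x = y.
Proof.
have far u v : within_box 9600%ZZ u -> beyond 9600%ZZ v v -> u <> v.
  by rewrite /within_box /beyond => -[] ? ? + uv; rewrite -uv; lia.
suff H : forall k x d y c, (d <= 14)%N -> (c <= 14)%N ->
    (x < 30 + 70 * k)%N -> (y < 30 + 70 * k)%N -> x <> y -> point k x <> point k y.
  by move=> xn yn; apply: contraPeq => /eqP; exact: (H k x 0%N y 0%N).
apply: local_ind => {k x y}.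
- move=> k x d y c k2 xn yn xy; have [_ _ _ un] := base_parts k2 => /eqP.
  by rewrite nth_uniq ?size_points // => /eqP.
- move=> k x d y c x10 y10 IH xn yn xy; rewrite !point_shift // => /scale_inj.
  by apply: IH; lia.
- move=> k x d y c xd yc IH xn yn; rewrite !point_prefix; [|lia|lia].
  by apply: IH; lia.
- move=> k x d y c k2 x80 y136 xn yn _; apply: far; first by apply: points_near; lia.
  by have := points_far k2 yn (or_introl erefl) y136; rewrite addn0.
- move=> k x d y c k2 x136 y80 xn yn _; apply/nesym/far; first by apply: points_near; lia.
  by have := points_far k2 xn (or_introl erefl) x136; rewrite addn0.
Qed.

(** * The tube has no 4-cycle *)

Definition adj (k x y : nat) : bool := ((y - x)%N \in up k x) || ((x - y)%N \in up k y).

Lemma adj_sym k x y : adj k x y = adj k y x. Proof. exact: orbC. Qed.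

Lemma adj_range k x y : adj k x y -> (x < 30 + 70 * k)%N.
Proof. by case/orP => d; have := up_range d; have := up_bound d; lia. Qed.

Lemma adj_close k x y : adj k x y -> (x <= y + 14)%N && (y <= x + 14)%N.
Proof. by case/orP => d; have := up_bound d; lia. Qed.

Lemma adj_neighbours k x y : adj k x y -> y \in neighbours k x.
Proof.
rewrite mem_cat => /orP[] d; have /andP[d0 d14] := up_bound d; apply/orP.
  by left; apply/mapP; exists (y - x)%N => //; lia.
by right; rewrite mem_filter d mem_iota; lia.
Qed.

Lemma adj_shift k x y : (10 <= x)%N -> (10 <= y)%N -> adj k.+1 (x + 70) (y + 70) = adj k x y.
Proof. by move=> x10 y10; rewrite /adj !subnDr !up_shift. Qed.

Lemma adj_prefix k x y : (x < 10 + 70 * k)%N -> (y < 10 + 70 * k)%N -> adj k.+1 x y = adj k x y.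
Proof. by move=> xk yk; rewrite /adj !up_prefix. Qed.

Lemma no_square_base k a b c d : (k <= 2)%N ->
  adj k a b -> adj k b c -> adj k c d -> adj k d a -> a != c -> b != d -> False.
Proof.
move=> k2 ab bc cd da ac bd; have /allP/(_ k) := squares_base; rewrite !inE.
have -> : [|| k == 0, k == 1 | k == 2]%N by lia.
move=> /(_ isT)/allP/(_ a); rewrite mem_iota => /(_ (adj_range ab)).
move=> /allP/(_ b (adj_neighbours ab))/allP/(_ d).
rewrite adj_sym in da; move/(_ (adj_neighbours da)); rewrite (negPf bd).
move/allP/(_ c (adj_neighbours bc)); rewrite eq_sym (negPf ac) /=.
by rewrite adj_neighbours // adj_sym.
Qed.

(** A 4-cycle spans at most 28 consecutive numbers on either side of a vertex,
    so it misses the first or the last of three bands. *)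
Lemma no_square k a b c d :
  adj k a b -> adj k b c -> adj k c d -> adj k d a -> a != c -> b != d -> False.
Proof.
elim: k a b c d => [|k IH] a b c d; first exact: no_square_base.
have [k2|k2] := leqP k.+1 2; first exact: no_square_base.
move=> ab bc cd da ac bd.
have := adj_close ab; have := adj_close bc; have := adj_close cd; have := adj_close da.
move=> da14 cd14 bc14 ab14.
have [low|high] := boolP [|| a < 80, b < 80, c < 80 | d < 80]%N.
  by apply: (IH a b c d) => //; rewrite -adj_prefix //; lia.
have shift x y : (80 <= x)%N -> (80 <= y)%N -> adj k.+1 x y -> adj k (x - 70) (y - 70).
  move=> x80 y80 xy; have := @adj_shift k (x - 70) (y - 70).
  by rewrite !subnK ?xy; [|lia|lia] => <- //; lia.
by apply: (IH (a - 70) (b - 70) (c - 70) (d - 70))%N; try (apply: shift => //); lia.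
Qed.

(** * Straight-line drawings *)

(** Coordinates are binary integers, for the sake of computation. *)
Definition z2r (R : pzRingType) (z : Z) : R := (int_of_Z z)%:~R.

Lemma z2rD (R : pzRingType) x y : z2r R (x + y)%ZZ = z2r R x + z2r R y.
Proof. by rewrite /z2r -intrD -(raddfD int_of_Z). Qed.

Lemma z2rM (R : pzRingType) x y : z2r R (x * y)%ZZ = z2r R x * z2r R y.
Proof. by rewrite /z2r -intrM -(rmorphM int_of_Z). Qed.

Lemma z2r_inj (R : realType) : injective (z2r R).
Proof. by move=> x y /intr_inj/(can_inj int_of_ZK). Qed.

Lemma z2r_le0 (R : realType) x : (x <= 0)%ZZ -> z2r R x <= 0.
Proof. by move=> x0; rewrite /z2r lerz0; lia. Qed.

Lemma z2r_ge0 (R : realType) x : (0 <= x)%ZZ -> 0 <= z2r R x.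
Proof. by move=> x0; rewrite /z2r ler0z; lia. Qed.

Lemma z2r_lt0 (R : realType) x : (x < 0)%ZZ -> z2r R x < 0.
Proof. by move=> x0; rewrite /z2r ltrz0; lia. Qed.

Lemma z2r_gt0 (R : realType) x : (0 < x)%ZZ -> 0 < z2r R x.
Proof. by move=> x0; rewrite /z2r ltr0z; lia. Qed.

Definition z2p (R : realType) (p : Z * Z) : R * R := (z2r R p.1, z2r R p.2).

Definition segment (R : realType) (a b : R * R) (t : R) : R * R :=
  ((1 - t) * a.1 + t * b.1, (1 - t) * a.2 + t * b.2).

Definition formR (R : realType) (A B C : Z) (p : R * R) : R :=
  z2r R A * p.1 + z2r R B * p.2 + z2r R C.

Lemma formRE (R : realType) A B C p : formR A B C (z2p R p) = z2r R (form A B C p).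
Proof. by rewrite /formR /form !z2rD !z2rM. Qed.

Lemma formR_segment (R : realType) A B C (a b : R * R) t :
  formR A B C (segment a b t) = (1 - t) * formR A B C a + t * formR A B C b.
Proof. by rewrite /formR /segment /=; lra. Qed.

Lemma sep_disjoint (R : realType) a b c d (s t : R) : sep a b c d ->
  s \in `]0, 1[ -> t \in `]0, 1[ ->
  segment (z2p R a) (z2p R b) s <> segment (z2p R c) (z2p R d) t.
Proof.
case=> A [B [C [/(z2r_le0 R) a0 /(z2r_le0 R) b0 /(z2r_ge0 R) c0 /(z2r_ge0 R) d0 strict]]].
rewrite !in_itv /= => /andP[s0 s1] /andP[t0 t1] /(congr1 (formR A B C)).
rewrite !formR_segment !formRE.
have : [\/ z2r R (form A B C a) < 0, z2r R (form A B C b) < 0,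
   0 < z2r R (form A B C c) | 0 < z2r R (form A B C d)].
  by case: strict => [/(z2r_lt0 R)|[/(z2r_lt0 R)|[/(z2r_gt0 R)|/(z2r_gt0 R)]]];
    [constructor 1|constructor 2|constructor 3|constructor 4].
by move: (z2r R _) (z2r R _) (z2r R _) (z2r R _) a0 b0 c0 d0 => w x y z ? ? ? ? [] ?; nra.
Qed.

Lemma off_segment_avoid (R : realType) a b v (t : R) : off_segment a b v ->
  t \in `]0, 1[ -> segment (z2p R a) (z2p R b) t <> z2p R v.
Proof.
case=> A [B [C [/(z2r_le0 R) a0 /(z2r_le0 R) b0 /(z2r_gt0 R) v0]]].
rewrite !in_itv /= => /andP[t0 t1] /(congr1 (formR A B C)).
rewrite !formR_segment !formRE; nra.
Qed.

Lemma segment_simple (R : realType) (a b : R * R) : a <> b -> simple_arc (segment a b).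
Proof.
move=> ab; split.
  have affine (u v : R) : continuous (fun r : R => (1 - r) * u + r * v).
    move=> r; apply: cvgD; apply: cvgM; try exact: cvg_cst; try exact: cvg_id.
    by apply: cvgB; [exact: cvg_cst|exact: cvg_id].
  apply: continuous_subspaceT => r.
  exact: (cvg_pair (affine a.1 b.1 r) (affine a.2 b.2 r)).
move=> s t _ _ [e1 e2]; apply/eqP/negPn/negP => st; apply: ab.
have st0 : s - t != 0 by rewrite subr_eq0.
rewrite [a]surjective_pairing [b]surjective_pairing; congr (_, _); apply: (mulfI st0); lra.
Qed.

Lemma segment_ends (R : realType) (a b : R * R) : segment a b 0 = a /\ segment a b 1 = b.
Proof.
rewrite /segment [a]surjective_pairing [b]surjective_pairing /=.
by split; congr (_, _); lra.
Qed.

(** Separation by lines for the edges and strict separation for the vertices off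
    an edge are all that a straight-line drawing has to satisfy. *)
Lemma straight_planar (R : realType) (T : finType) (G : sgraph T) (pos : T -> Z * Z)
    (ends : {set T} -> T * T) :
  injective pos ->
  (forall e, e \in edges G -> e = [set (ends e).1; (ends e).2]%SET) ->
  (forall e f, e \in edges G -> f \in edges G -> e != f ->
     sep (pos (ends e).1) (pos (ends e).2) (pos (ends f).1) (pos (ends f).2)) ->
  (forall e v, e \in edges G -> v \notin e ->
     off_segment (pos (ends e).1) (pos (ends e).2) (pos v)) ->
  planar R G.
Proof.
move=> pos_inj endsP sepP offP.
have z2p_inj : injective (z2p R).
  by move=> [a b] [c d] [] /z2r_inj -> /z2r_inj ->.
pose a e := z2p R (pos (ends e).1); pose b e := z2p R (pos (ends e).2).
have ab e : e \in edges G -> a e <> b e.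
  move=> eG /z2p_inj/pos_inj e12; have := card_edge eG.
  by rewrite {1}(endsP e eG) e12 finset.setUid cards1.
have seg0 e : segment (a e) (b e) 0 = a e by have [] := segment_ends (a e) (b e).
have seg1 e : segment (a e) (b e) 1 = b e by have [] := segment_ends (a e) (b e).
exists (fun v => z2p R (pos v)), (fun e => segment (a e) (b e)); split.
- by move=> u v /z2p_inj/pos_inj.
- move=> e eG; split; first by apply: segment_simple; exact: ab.
  by exists (ends e).1, (ends e).2; split; [exact: endsP|exact: seg0|exact: seg1].
- move=> e t v eG tI; have [ve|ve] := boolP (v \in e); last first.
    by apply: off_segment_avoid => //; exact: offP.
  have tI' : t \in `[0, 1] by move: tI; rewrite !in_itv /= => /andP[/ltW -> /ltW ->].
  have [_ inj] := segment_simple (ab e eG).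
  have /orP[] : (v == (ends e).1) || (v == (ends e).2).
    by move: ve; rewrite {1}(endsP e eG) !inE.
    move=> /eqP ->; rewrite -/(a e) -{2}(seg0 e) => /inj; rewrite tI' in_itv /= lexx ler01.
    by move=> /(_ isT isT) t0; move: tI; rewrite t0 in_itv /= ltxx.
  move=> /eqP ->; rewrite -/(b e) -{2}(seg1 e) => /inj; rewrite tI' in_itv /= lexx ler01.
  by move=> /(_ isT isT) t0; move: tI; rewrite t0 in_itv /= ltxx andbF.
- by move=> e f s t eG fG ef sI tI; apply: sep_disjoint => //; exact: sepP.
Qed.

(** * The extremal graphs and the theorem *)

Definition tube_arcs (k : nat) : {set 'I_(30 + 70 * k) * 'I_(30 + 70 * k)} :=
  [set p : 'I_(30 + 70 * k) * 'I_(30 + 70 * k) | (p.2 - p.1)%N \in up k p.1]%SET.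

Definition tube_edges (k : nat) : {set {set 'I_(30 + 70 * k)}} :=
  [set [set p.1; p.2] | p in tube_arcs k]%SET.

Lemma tube_arc_lt k p : p \in tube_arcs k -> (p.1 < p.2)%N.
Proof. by rewrite inE => /up_bound/andP[d0 _]; rewrite -subn_gt0. Qed.

Lemma tube_edges_card k : [forall e in tube_edges k, #|e| == 2%N].
Proof.
apply/forall_inP => _ /imsetP[p pk ->]; rewrite cards2.
by rewrite neq_ltn tube_arc_lt.
Qed.

Definition tube (k : nat) : sgraph 'I_(30 + 70 * k) := SGraph (tube_edges_card k).

Lemma tube_adj k (x y : 'I_(30 + 70 * k)) : [set x; y]%SET \in edges (tube k) -> adj k x y.
Proof.
case/imsetP => p pk xyE; have lt := tube_arc_lt pk; rewrite inE in pk.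
have : p.2 \in [set x; y]%SET by rewrite xyE !inE eqxx orbT.
have : p.1 \in [set x; y]%SET by rewrite xyE !inE eqxx.
rewrite /adj !inE => /orP[] /eqP p1 /orP[] /eqP p2; rewrite -?p1 -?p2 ?pk ?orbT //.
- by rewrite p1 -p2 ltnn in lt.
- by rewrite p1 -p2 ltnn in lt.
Qed.

Lemma tube_C4_free k : subgraph_free C4 (tube k).
Proof.
case=> f [f_inj fE].
have step (i : 'I_4) : adj k (f i) (f (ordS i)).
  have := fE [set i; ordS i]%SET; rewrite imsetU1 imset_set1.
  by move=> fi; apply/tube_adj/fi/imsetP; exists i.
pose o (i : nat) (i4 : (i < 4)%N) : 'I_4 := Ordinal i4.
have next i (i4 : (i < 4)%N) j (j4 : (j < 4)%N) : (i.+1 %% 4 = j)%N ->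
    adj k (f (o i i4)) (f (o j j4)).
  move=> ij; have := step (o i i4); congr adj; congr (nat_of_ord (f _)).
  by apply: val_inj; rewrite /= ij.
have neq i (i4 : (i < 4)%N) j (j4 : (j < 4)%N) : i != j -> f (o i i4) != f (o j j4) :> nat.
  by apply: contra_neq => /val_inj/f_inj[].
exact: (no_square (next 0%N isT 1%N isT erefl) (next 1%N isT 2%N isT erefl)
  (next 2%N isT 3%N isT erefl) (next 3%N isT 0%N isT erefl)
  (neq 0%N isT 2%N isT isT) (neq 1%N isT 3%N isT isT)).
Qed.

Lemma tube_size k : #|edges (tube k)| = (60 + 150 * k)%N.
Proof.
rewrite card_in_imset; last first.
  move=> [x y] [z w] /tube_arc_lt /= xy /tube_arc_lt /= zw /setP E.
  have := E x; have := E y; have := E z; have := E w; rewrite !inE !eqxx ?orbT /=.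
  by rewrite -!val_eqE /= => ? ? ? ?; congr (_, _); apply: val_inj => /=; lia.
rewrite card_set_sum.
rewrite -(pair_bigA _ (fun x y : 'I_(30 + 70 * k) => nat_of_bool ((y - x)%N \in up k x))) /=.
have row (x : 'I_(30 + 70 * k)) :
    (\sum_(y < 30 + 70 * k) ((y - x)%N \in up k x) = size (up k x))%N.
  rewrite -(big_mkord xpredT (fun y => nat_of_bool ((y - x)%N \in up k x))) -big_mkcond /=.
  rewrite sum1_count /index_iota subn0 -(size_map (addn x)) -size_filter.
  apply/perm_size/uniq_perm.
  - by rewrite filter_uniq // iota_uniq.
  - by rewrite map_inj_uniq ?up_uniq //; exact: addnI.
  move=> y; rewrite mem_filter mem_iota /=; apply/andP/mapP => [[yx yn]|[d dx ->]].
    by exists (y - x)%N => //; have := up_bound yx; lia.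
  by rewrite addKn dx up_range.
under eq_bigr do rewrite row.
have -> : (\sum_(x < 30 + 70 * k) size (up k x) = sumn (map size (links k)))%N.
  by rewrite sumnE big_map (big_nth [::]) size_links big_mkord.
rewrite /links !map_cat !sumn_cat map_flatten map_nseq.
have sumn_nseq_flatten (s : seq nat) : (sumn (flatten (nseq k s)) = sumn s * k)%N.
  by elim: k {row} => [|m IH] /=; rewrite ?muln0 // sumn_cat IH mulnS.
rewrite sumn_nseq_flatten (erefl : sumn (map size cap_links) = 25%N).
rewrite (erefl : sumn (map size band_links) = 150%N) (erefl : sumn (map size lid_links) = 35%N).
lia.
Qed.

Lemma tube_planar (R : realType) k : planar R (tube k).
Proof.
have i0 : 'I_(30 + 70 * k) by exists 0%N; lia.
have /choice[ends endsP] : forall e, exists p, e \in edges (tube k) ->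
    p \in tube_arcs k /\ e = [set p.1; p.2]%SET.
  move=> e; have [/imsetP[p pk ->]|_] := boolP (e \in edges (tube k)); first by exists p.
  by exists (i0, i0).
have arcE e : e \in edges (tube k) ->
    exists2 d, d \in up k (ends e).1 & (ends e).2 = ((ends e).1 + d)%N :> nat.
  move=> /endsP[eA _]; exists ((ends e).2 - (ends e).1)%N; first by move: eA; rewrite inE.
  by have := tube_arc_lt eA; lia.
apply: (@straight_planar R _ (tube k) (fun i => point k i) ends).
- by move=> i j /point_inj ij; apply: val_inj; apply: ij.
- by move=> e /endsP[].
- move=> e f eG fG ef; have [d de e2] := arcE e eG; have [c cf f2] := arcE f fG.
  rewrite e2 f2; apply: edges_sep => //; apply: contra_neq ef => -[ef dc].
  have [_ ->] := endsP e eG; have [_ ->] := endsP f fG.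
  by congr [set _; _]%SET; apply: val_inj => //; rewrite /= e2 f2 ef dc.
- move=> e v eG ve; have [d de e2] := arcE e eG.
  have [_ eE] := endsP e eG; move: ve; rewrite {1}eE !inE negb_or => /andP[v1 v2].
  by rewrite e2; apply: vertex_off => //; rewrite -?e2 ?val_eqE.
Qed.

Theorem theorem3 (R : realType) (n : nat) (n_gt0 : (0 < n)%N)
    (n_mod : n = 30 %[mod 70]) :
  (ex_planar R n C4)%:R = 15%:R / 7%:R * (n%:R - 2%:R) :> rat.
Proof.
have {n_gt0 n_mod} [k ->] : exists k, n = (30 + 70 * k)%N.
  by exists (n %/ 70)%N; move: n_mod; have := divn_eq n 70; lia.
suff -> : ex_planar R (30 + 70 * k) C4 = (60 + 150 * k)%N.
  by rewrite (natrD _ 60) (natrD _ 30) (natrM _ 150) (natrM _ 70); field.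
apply/eqP; rewrite eqn_leq; apply/andP; split.
  apply/bigmax_leqP => G /asboolP[plG free].
  have := planar_C4_free_bound _ plG free; rewrite card_ord => /(_ isT); lia.
rewrite -tube_size; apply: (leq_bigmax_cond (tube k)).
by apply/asboolP; split; [exact: tube_planar|exact: tube_C4_free].
Qed.
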